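(* For every $1\leq m<n$, the $m$-th moment of the Margulis $\alpha$-function is finite, i.e., $$\int_{\mathcal{L}_n}\alpha^m\,dm_{\mathcal{L}_n}<\infty.$$
   Context: Let $q$ be a power of an odd prime, $\mathcal{R}=\mathbb{F}_q[x]$, $\mathcal{K}_\infty=\mathbb{F}_q((x^{-1}))$ with absolute value normalized by $|x|=q$. Let $\mathrm{G}=\mathrm{SL}_n(\mathcal{K}_\infty)$, for which the paper's convention is $\{g\in\mathrm{GL}_n(\mathcal{K}_\infty):|\det g|=1\}$, let $\Gamma=\mathrm{SL}_n(\mathcal{R})$, and let $\mathcal{L}_n=\mathrm{G}/\Gamma$ be the space of unimodular $\mathcal{R}$-lattices, where $g\Gamma$ corresponds to the lattice $\Lambda=g\mathcal{R}^n$; $m_{\mathcal{L}_n}$ is the $\mathrm{G}$-invariant probability measure on $\mathcal{L}_n$. Margulis $\alpha$-function: for $0\le k\le n$ and a $k$-sublattice $\Delta=\mathcal{R}\mathbf{v}_1+\dots+\mathcal{R}\mathbf{v}_k$ of $\Lambda$ with $\mathbf{v}_1,\dots,\mathbf{v}_k\in\mathcal{K}_\infty^n$ linearly independent, put $L(\Delta)=\Vert\mathbf{v}_1\wedge\dots\wedge\mathbf{v}_k\Vert$ (maximum of the absolute values of the coordinates in the standard basis of $\bigwedge^k\mathcal{K}_\infty^n$; $L=1$ for $k=0$). Put $\alpha_k(\Lambda)=\max\{1/L(\Delta):\Delta\text{ is a }k\text{-sublattice of }\Lambda\}$ and $\alpha(\Lambda)=\max_{k=0,\dots,n}\alpha_k(\Lambda)$.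 *)

(* Defs.v *)
From HB Require Import structures.
From mathcomp Require Import all_boot all_order all_algebra.
From mathcomp Require Import all_classical all_reals all_analysis.
From mathcomp Require Import zify.

Set Implicit Arguments.
Unset Strict Implicit.
Unset Printing Implicit Defensive.

Import Order.TTheory GRing.Theory Num.Theory.

Local Open Scope classical_set_scope.
Local Open Scope ring_scope.

(* An element of F((x^-1)) is a formal sum of [lcoef f i * x^i] over the
   integers [i <= N], for some [N] depending on [f]. *)
Record laurent (F : fieldType) := Laurent {
  lcoef :> int -> F;
  lcoef_bounded : exists N : int, forall i, N < i -> lcoef i = 0 }.

HB.instance Definition _ (F : fieldType) := gen_eqMixin (laurent F).
HB.instance Definition _ (F : fieldType) := gen_choiceMixin (laurent F).

Section LaurentField.
Variable F : fieldType.
Implicit Types (f g h : laurent F) (a b : int -> F) (M N L : int).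

Lemma laurentP f g : (forall i, f i = g i) -> f = g.
Proof.
case: f g => [a Ha] [b Hb] /= /funext eab; rewrite {a}eab in Ha *.
by congr Laurent; exact: Prop_irrelevance.
Qed.

Definition lbd N a := forall i, N < i -> a i = 0.

Lemma lbdW N M a : N <= M -> lbd N a -> lbd M a.
Proof. by move=> NM aN i Mi; apply: aN; exact: le_lt_trans Mi. Qed.

Lemma lbd2 f g : exists N, lbd N f /\ lbd N g.
Proof.
have [M fM] := lcoef_bounded f; have [N gN] := lcoef_bounded g.
exists (Num.max M N); split.
  by apply: lbdW fM; rewrite le_max lexx.
by apply: lbdW gN; rewrite le_max lexx orbT.
Qed.

Lemma ladd_bounded f g : exists N, lbd N (fun i => f i + g i).
Proof.
by have [N [fN gN]] := lbd2 f g; exists N => i Ni; rewrite fN// gN// addr0.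
Qed.

Lemma lopp_bounded f : exists N, lbd N (fun i => - f i).
Proof. by have [N fN] := lcoef_bounded f; exists N => i Ni; rewrite fN// oppr0. Qed.

Lemma lzero_bounded : exists N, lbd N (fun=> 0).
Proof. by exists 0. Qed.

Definition lzero := Laurent lzero_bounded.
Definition ladd f g := Laurent (ladd_bounded f g).
Definition lopp f := Laurent (lopp_bounded f).

Lemma laddA : associative ladd.
Proof. by move=> f g h; apply: laurentP => i /=; rewrite addrA. Qed.
Lemma laddC : commutative ladd.
Proof. by move=> f g; apply: laurentP => i /=; rewrite addrC. Qed.
Lemma ladd0 : left_id lzero ladd.
Proof. by move=> f; apply: laurentP => i /=; rewrite add0r. Qed.
Lemma laddN : left_inverse lzero lopp ladd.
Proof. by move=> f; apply: laurentP => i /=; rewrite addNr. Qed.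

HB.instance Definition _ :=
  GRing.isZmodule.Build (laurent F) laddA laddC ladd0 laddN.

(* Cauchy product; the sum has finite support. *)
Definition conv a b (k : int) : F := \sum_(i \in [set: int]) a i * b (k - i).

Definition trunc M m a : {poly F} := \poly_(j < m) a (M - j%:Z).

Lemma convE M N a b (n : nat) : lbd M a -> lbd N b ->
  conv a b (M + N - n%:Z) =
  \sum_(j < n.+1) a (M - j%:Z) * b (N - (n - j)%N%:Z).
Proof.
move=> aM bN; rewrite /conv.
rewrite (@fsbigE _ _ _ _ _ [seq M - j%:Z | j <- iota 0 n.+1])//; last first.
- move=> i _; apply: contraNeq; rewrite mulf_eq0 negb_or => /andP[ai bi].
  have iM : i <= M by rewrite leNgt; apply/negP => /aM/eqP; exact/negP.
  have iN : M + N - n%:Z - i <= N.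
    by rewrite leNgt; apply/negP => /bN/eqP; exact/negP.
  apply/mapP; exists `|M - i|%N; last by lia.
  by rewrite mem_iota; lia.
- by rewrite map_inj_uniq ?iota_uniq// => i j; lia.
rewrite [X in X = _](_ : _ =
    \sum_(i <- [seq M - j%:Z | j <- iota 0 n.+1]) a i * b (M + N - n%:Z - i)).
  rewrite big_map -[iota 0 n.+1]/(index_iota 0 n.+1) big_mkord.
  by apply: eq_bigr => j _; congr (_ * b _); have := ltn_ord j; lia.
by apply: eq_bigl => i; rewrite in_setT.
Qed.

Lemma conv_trunc M N a b (n m : nat) : lbd M a -> lbd N b -> (n < m)%N ->
  conv a b (M + N - n%:Z) = (trunc M m a * trunc N m b)`_n.
Proof.
move=> aM bN nm; rewrite convE// coefM; apply: eq_bigr => j _.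
by rewrite !coef_poly !ifT//; have := ltn_ord j; lia.
Qed.

Lemma conv_lbd M N a b : lbd M a -> lbd N b -> lbd (M + N) (conv a b).
Proof.
move=> aM bN k Mk; rewrite /conv fsbig1// => i _.
have [Mi|iM] := ltP M i; first by rewrite aM// mul0r.
by rewrite bN ?mulr0//; lia.
Qed.

Lemma conv_bounded f g : exists N, lbd N (conv f g).
Proof.
have [M fM] := lcoef_bounded f; have [N gN] := lcoef_bounded g.
by exists (M + N); exact: conv_lbd.
Qed.

Definition lmul f g := Laurent (conv_bounded f g).

Lemma lbd_eq N a b : lbd N a -> lbd N b ->
  (forall n : nat, a (N - n%:Z) = b (N - n%:Z)) -> forall i, a i = b i.
Proof.
move=> aN bN ab i; have [Ni|iN] := ltP N i; first by rewrite aN ?bN.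
by rewrite (_ : i = N - `|N - i|%N%:Z) ?ab//; lia.
Qed.

Lemma trunc_conv M N a b (n m : nat) : lbd M a -> lbd N b -> (n < m)%N ->
  (trunc (M + N) m (conv a b))`_n = (trunc M m a * trunc N m b)`_n.
Proof. by move=> aM bN nm; rewrite coef_poly nm (conv_trunc aM bN nm). Qed.

Lemma coefM_eq (p q p' q' : {poly F}) n :
  (forall j, (j <= n)%N -> p`_j = p'`_j) ->
  (forall j, (j <= n)%N -> q`_j = q'`_j) -> (p * q)`_n = (p' * q')`_n.
Proof.
move=> pp qq; rewrite !coefM; apply: eq_bigr => j _.
by rewrite pp ?qq//; have := ltn_ord j; lia.
Qed.

Lemma lmulC : commutative lmul.
Proof.
move=> f g; have [M fM] := lcoef_bounded f; have [N gN] := lcoef_bounded g.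
apply: laurentP; apply: (@lbd_eq (M + N)).
- exact: conv_lbd.
- by rewrite addrC; exact: conv_lbd.
move=> n /=; rewrite (conv_trunc fM gN (ltnSn n)) mulrC.
by rewrite -(conv_trunc gN fM (ltnSn n)) (addrC N).
Qed.

Lemma lmulA : associative lmul.
Proof.
move=> f g h; have [M fM] := lcoef_bounded f; have [N gN] := lcoef_bounded g.
have [L hL] := lcoef_bounded h.
have fgB := conv_lbd fM gN; have ghB := conv_lbd gN hL.
apply: laurentP; apply: (@lbd_eq (M + (N + L))).
- exact: conv_lbd.
- by rewrite addrA; exact: conv_lbd.
move=> n /=; rewrite (conv_trunc fM ghB (ltnSn n)).
rewrite addrA (conv_trunc fgB hL (ltnSn n)).
rewrite (@coefM_eq _ _ (trunc M n.+1 f) (trunc N n.+1 g * trunc L n.+1 h))//.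
  rewrite mulrA; apply: coefM_eq => // j jn.
  by rewrite (trunc_conv fM gN).
by move=> j jn; rewrite (trunc_conv gN hL).
Qed.

Lemma lone_bounded : exists N, lbd N (fun i => (i == 0)%:R : F).
Proof. by exists 0 => i i0; rewrite gt_eqF. Qed.

Definition lone := Laurent lone_bounded.

Lemma lmul1 : left_id lone lmul.
Proof.
move=> f; apply: laurentP => k /=; rewrite /conv.
rewrite (@fsbigE _ _ _ _ _ [:: 0])//.
  by rewrite big_mkcond big_seq1/= in_setT mul1r subr0.
by move=> i _; rewrite inE => /negPf ->; rewrite mul0r.
Qed.

Lemma lmulDl : left_distributive lmul (+%R : laurent F -> _).
Proof.
move=> f g h; have [N [fN gN]] := lbd2 f g; have [L hL] := lcoef_bounded h.
have fgN : lbd N (f + g) by move=> i Ni /=; rewrite fN// gN// addr0.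
apply: laurentP; apply: (@lbd_eq (N + L)).
- exact: conv_lbd.
- move=> i Ni /=.
  by rewrite (conv_lbd fN hL Ni) (conv_lbd gN hL Ni) addr0.
move=> n /=; rewrite !(convE _ fgN hL, convE _ fN hL, convE _ gN hL).
by rewrite -big_split/=; apply: eq_bigr => j _; rewrite mulrDl.
Qed.

Lemma lone_neq0 : lone != 0.
Proof.
by apply/eqP => /(congr1 (fun f : laurent F => f 0))/eqP; rewrite /= oner_eq0.
Qed.

HB.instance Definition _ := GRing.Zmodule_isComNzRing.Build (laurent F)
  lmulA lmulC lmul1 lmulDl lone_neq0.

Definition is_ldeg f (d : int) := f d != 0 /\ lbd d f.

Lemma is_ldeg_ex f : f != 0 -> exists d, is_ldeg f d.
Proof.
move=> f0; have [N fN] := lcoef_bounded f.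
have [i fi] : exists i, f i != 0.
  apply: contrapT => /forallNP fi0; move/eqP: f0; apply; apply: laurentP => i.
  by apply/eqP; apply: contrapT => /negP; exact: fi0.
have iN : i <= N by rewrite leNgt; apply/negP => /fN/eqP; exact/negP.
pose P k := f (N - k%:Z) != 0.
have exP : exists k, P k by exists `|N - i|%N; rewrite /P (_ : _ - _ = i)//; lia.
have [k Pk minP] := ex_minnP exP.
exists (N - k%:Z); split=> // j jk; have [/fN//|jN] := ltP N j.
apply/eqP; apply: contraT => fj; have := minP `|N - j|%N.
rewrite /P (_ : N - `|N - j|%N%:Z = j); last by lia.
by move=> /(_ fj); lia.
Qed.

Lemma is_ldeg_uniq f d e : is_ldeg f d -> is_ldeg f e -> d = e.
Proof.
move=> [fd fdb] [fe feb]; apply/eqP; rewrite eq_le !leNgt.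
apply/andP; split; apply/negP; first by move=> /feb/eqP; exact/negP.
by move=> /fdb/eqP; exact/negP.
Qed.

(* The degree in [x] of a nonzero series. *)
Definition ldeg f : int := xget 0 [set d | is_ldeg f d].

Lemma ldegP f : f != 0 -> is_ldeg f (ldeg f).
Proof. by move=> /is_ldeg_ex fd; exact: (xgetPex 0 fd). Qed.

Fixpoint invseq (a : nat -> F) (n : nat) : seq F :=
  if n is n'.+1 then
    let s := invseq a n' in
    rcons s (if n' == 0%N then (a 0%N)^-1
             else - (a 0%N)^-1 * \sum_(j < n') a (n' - j)%N * s`_j)
  else [::].

Lemma size_invseq (a : nat -> F) n : size (invseq a n) = n.
Proof. by elim: n => //= n IHn; rewrite size_rcons IHn. Qed.

Lemma nth_invseq (a : nat -> F) m n : (n < m)%N ->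
  (invseq a m)`_n = (invseq a n.+1)`_n.
Proof.
elim: m => // m IHm; rewrite ltnS leq_eqVlt => /predU1P[->//|nm].
by rewrite [LHS]/= nth_rcons size_invseq nm IHm.
Qed.

Lemma invseqP (a : nat -> F) n : a 0%N != 0 ->
  \sum_(j < n.+1) a (n - j)%N * (invseq a j.+1)`_j = (n == 0%N)%:R.
Proof.
move=> a0; rewrite big_ord_recr/= subnn nth_rcons size_invseq ltnn eqxx.
case: eqP => [->|_]; first by rewrite big_ord0 add0r mulfV.
rewrite mulNr mulrN mulrA mulfV// mul1r; apply/eqP; rewrite subr_eq0; apply/eqP.
by apply: eq_bigr => j _; rewrite [in RHS]nth_invseq.
Qed.

Lemma linv_ex f : f != 0 -> exists g, g * f = 1.
Proof.
move=> /ldegP; move: (ldeg f) => d [fd fdb].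
pose a (j : nat) := f (d - j%:Z).
pose b (i : int) :=
  if i <= - d then (invseq a (absz (- d - i)).+1)`_(absz (- d - i)) else 0.
have bb : lbd (- d) b by move=> i di; rewrite /b leNgt di.
exists (Laurent (ex_intro (fun N => lbd N b) _ bb)); apply: laurentP.
apply: (@lbd_eq (- d + d)).
- exact: conv_lbd.
- by move=> i; rewrite addNr => i0 /=; rewrite gt_eqF.
move=> n /=; rewrite convE// addNr sub0r oppr_eq0 [RHS](_ : _ = (n == 0%N)%:R)//.
have a0 : a 0%N != 0 by rewrite /a subr0.
rewrite -(invseqP n a0); apply: eq_bigr => j _; rewrite mulrC; congr (_ * _).
rewrite /b ifT; last by lia.
by rewrite (_ : absz (- d - (- d - j%:Z))%R = j)//; lia.
Qed.

Definition linv f : laurent F := xget 0 [set g | g * f = 1].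

Lemma linvP f : f != 0 -> linv f * f = 1.
Proof. by move=> /linv_ex fg; exact: (xgetPex 0 fg). Qed.

Lemma linv0 : linv 0 = 0.
Proof.
rewrite /linv; case: xgetP => // g _ /= /eqP.
by rewrite mulr0 eq_sym oner_eq0.
Qed.

HB.instance Definition _ :=
  GRing.ComNzRing_isField.Build (laurent F) linvP linv0.

(* Two series are close when they have the same coefficients in all degrees
   [i >= N], i.e. when [|f - g| < q ^ N]; see [absv_ltP] below. *)
Definition lball f N : set (laurent F) :=
  [set g | forall i, N <= i -> g i = f i].

Definition lnbhs f : set_system (laurent F) :=
  [set A | exists N, lball f N `<=` A].

HB.instance Definition _ := hasNbhs.Build (laurent F) lnbhs.

Lemma lnbhs_filter f : ProperFilter (nbhs f).
Proof.
apply: Build_ProperFilter_ex; first by move=> A [N NA]; exists f; exact: NA.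
split; first by exists 0.
- move=> A B [M MA] [N NB]; exists (Num.min M N) => g fg.
  split; [apply: MA|apply: NB] => i Ni; apply: fg; apply: le_trans Ni.
    by rewrite ge_min lexx.
  by rewrite ge_min lexx orbT.
- by move=> A B AB [N NA]; exists N; exact: subset_trans AB.
Qed.

Lemma lnbhs_singleton f A : nbhs f A -> A f.
Proof. by move=> [N NA]; exact: NA. Qed.

Lemma lnbhs_nbhs f A : nbhs f A -> nbhs f (nbhs^~ A).
Proof.
move=> [N NA]; exists N => g gf; exists N => h hg; apply: NA => i Ni.
by rewrite hg// gf.
Qed.

HB.instance Definition _ := Nbhs_isNbhsTopological.Build (laurent F)
  lnbhs_filter lnbhs_singleton lnbhs_nbhs.

Lemma lpoly_bounded (p : {poly F}) :
  exists N, lbd N (fun i => if i is Posz k then p`_k else 0).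
Proof.
by exists (size p)%:Z => -[k|//]; rewrite ltz_nat => /ltnW/(nth_default 0).
Qed.

(* The embedding of F[x] into F((x^-1)). *)
Definition lpoly (p : {poly F}) := Laurent (lpoly_bounded p).

End LaurentField.

Section AbsoluteValue.
Variable F : finFieldType.

(* [|f| = q ^ deg f], so that [|x| = q]; rational values suffice. *)
Definition absv (f : laurent F) : rat :=
  if f == 0 then 0 else #|F|%:R ^ ldeg f.

Lemma absv_ltP (f g : laurent F) (N : int) :
  reflect (lball f N g) (absv (g - f) < #|F|%:R ^ N).
Proof.
have q1 : 1 < #|F|%:R :> rat by rewrite ltr1n card_finNzRing_gt1.
rewrite /absv; have [/eqP|gf0] := eqVneq.
  rewrite subr_eq0 => /eqP ->.
  by rewrite exprz_gt0 ?(lt_trans _ q1)//; apply: ReflectT.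
have [fd fdb] := ldegP gf0; rewrite ltr_eXz2l//.
apply: (iffP idP) => [dN i Ni|fgN].
  by apply/eqP; rewrite -subr_eq0; apply/eqP/(fdb i); exact: lt_le_trans Ni.
rewrite ltNge; apply: contra fd => /fgN e; apply/eqP.
by rewrite [LHS](_ : _ = g (ldeg (g - f)) - f (ldeg (g - f)))// e subrr.
Qed.

Lemma absv1 : absv 1 = 1.
Proof.
rewrite /absv oner_eq0 (_ : ldeg 1 = 0) ?expr0z//.
apply: (@is_ldeg_uniq F 1); first exact/ldegP/oner_neq0.
by split=> [|i i0] /=; rewrite ?eqxx ?oner_eq0// gt_eqF.
Qed.

End AbsoluteValue.

Section Lattices.
Variables (F : finFieldType) (n : nat).
Local Notation K := (laurent F).

Definition GLset (A : set K) : set 'M[K]_n :=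
  [set g | g \in unitmx /\ forall i j, A (g i j) /\ A (invmx g i j)].

(* The convention for SL_n over a subring [A] of [K]: absolute value of the
   determinant equal to 1, both for [A = K] and for [A = F[x]]. Over [F[x]] it
   gives all of GL_n(F[x]), which is the stabilizer of [F[x]^n], so that the
   cosets are exactly the unimodular lattices. *)
Definition SLset (A : set K) : set 'M[K]_n :=
  GLset A `&` [set g | absv (\det g) = 1].

Lemma SLset1 (A : set K) : A 0 -> A 1 -> SLset A 1%:M.
Proof.
move=> A0 A1; split; last by rewrite /= det1 absv1.
split=> [|i j]; first exact: unitmx1.
by rewrite invmx1 !mxE; case: eqP.
Qed.

Definition G : Type := set_type (SLset setT).
HB.instance Definition _ := Topological.on G.

Definition Gval (g : G) : 'M[K]_n := set_val g.

Definition Gamma : set 'M[K]_n := SLset (range (@lpoly F)).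

Definition coset (g : G) : set 'M[K]_n :=
  [set Gval g *m gamma | gamma in Gamma].

Definition Ln : Type := set_type (range coset).
HB.instance Definition _ := Choice.on Ln.

Definition Lnval (X : Ln) : set 'M[K]_n := set_val X.

Definition piLn (g : G) : Ln := SigSub (mem_set (imageT coset g)).

HB.instance Definition _ :=
  isPointed.Build Ln (piLn (SigSub (mem_set (@SLset1 setT I I)))).

Definition Ln_open (A : set Ln) := open (piLn @^-1` A).

Lemma Ln_openT : Ln_open setT.
Proof. by rewrite /Ln_open preimage_setT; exact: openT. Qed.

Lemma Ln_openI : setI_closed Ln_open.
Proof. by move=> A B oA oB; exact: openI. Qed.

Lemma Ln_open_bigU (I : Type) (f : I -> set Ln) :
  (forall i, Ln_open (f i)) -> Ln_open (\bigcup_i f i).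
Proof. by move=> of_; apply: bigcup_open => i _; exact: of_. Qed.

HB.instance Definition _ :=
  isOpenTopological.Build Ln Ln_openT Ln_openI Ln_open_bigU.

Definition Ln_borel := g_sigma_algebraType (@open Ln).

(* The image of [A] under left translation by [g]. *)
Definition Ltrans (g : G) (A : set Ln) : set Ln :=
  [set Y | exists2 X, A X & Lnval Y = [set Gval g *m h | h in Lnval X]].

Definition G_invariant (R : realType) (mu : set Ln_borel -> \bar R) :=
  forall (g : G) (A : set Ln_borel), measurable A -> mu (Ltrans g A) = mu A.

Definition polyvec k : set 'cV[K]_k :=
  [set v | forall i, range (@lpoly F) (v i ord0)].

(* [lattice (g Gamma) = g F[x]^n], since [Gamma F[x]^n = F[x]^n]. *)
Definition lattice (X : Ln) : set 'cV[K]_n :=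
  [set v | exists2 g, Lnval X g & exists2 w, polyvec w & v = g *m w].

(* The [F[x]]-module generated by the columns of [V]. *)
Definition polyspan k (V : 'M[K]_(n, k)) : set 'cV[K]_n :=
  [set V *m a | a in @polyvec k].

(* The coordinates of [v_1 /\ ... /\ v_k] on the standard basis
   [e_(f 0) /\ ... /\ e_(f (k-1))], [f] increasing, are the maximal minors of
   the matrix [V] with columns [v_1, ..., v_k]. *)
Definition wedge_norm k (V : 'M[K]_(n, k)) : rat :=
  \big[Num.max/0]_(f : {ffun 'I_k -> 'I_n} |
      [forall i : 'I_k, forall j : 'I_k, (i < j)%N ==> (f i < f j)%N])
    absv (\det (rowsub f V)).

Definition sublattice_basis k (Lambda : set 'cV[K]_n) (V : 'M[K]_(n, k)) :=
  \rank V = k /\ polyspan V `<=` Lambda.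

(* The supremum is a maximum when [Lambda] is a lattice and [k <= n]. *)
Definition alphak (R : realType) k (Lambda : set 'cV[K]_n) : \bar R :=
  ereal_sup [set (ratr (wedge_norm V)^-1)%:E |
             V in [set V : 'M[K]_(n, k) | sublattice_basis Lambda V]].

Definition alpha (R : realType) (Lambda : set 'cV[K]_n) : \bar R :=
  \big[Order.max/-oo%E]_(k < n.+1) alphak R k Lambda.

End Lattices.

(* Main.v *)
Require Import Defs.
From HB Require Import structures.
From mathcomp Require Import all_boot all_order all_algebra.
From mathcomp Require Import all_classical all_reals all_analysis.
From mathcomp Require Import perm measurable_realfun zify ring lra.

(* Write [D = diag(x^d_1, ..., x^d_n)] with [sum d_i = 0], and let [U1] be the
   matrices over the valuation ring that are congruent to 1 modulo [x^-1].
   Reducing the leading coefficients of a basis shows that every unimodular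
   lattice is [C u D F[x]^n] with [C] in GL_n(F) and [u] in [U1]; reducing
   [D^-1 u D] once more turns this into [C D h F[x]^n] with [h] in the box
   [U1 /\ D^-1 U1 D]. Let [s] be the sum of the [- d_i] over [d_i < 0].
   - Minors do not grow under matrices over the valuation ring and nonzero
     polynomials have norm at least 1, so [alpha <= q^s] at this lattice.
   - By invariance the lattices [C D h F[x]^n] have the same measure as the
     lattices [(1 + Z) h F[x]^n], for each [Z] with entries [Z_ij] in the span
     of [x^-1, ..., x^-(d_i - d_j)] for [d_j < 0 <= d_i] and 0 otherwise. These
     are disjoint for distinct [Z], of which there are [q^(n s)], because
     [sum_(d_j < 0 <= d_i) (d_i - d_j) = n s]. So the measure is at most
     [q^(- n s)].
   There are at most [(2 s + 1)^n |GL_n(F)|] pairs [(C, d)] for a given [s], and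
   [sum_s (2 s + 1)^n q^((m - n) s)] converges for [m < n]. *)

Set Implicit Arguments.
Unset Strict Implicit.
Unset Printing Implicit Defensive.

Import Order.TTheory GRing.Theory Num.Theory.

Local Open Scope classical_set_scope.
Local Open Scope ring_scope.

(** * Formal Laurent series in the inverse of x *)

Section Series.
Variable F : fieldType.
Local Notation K := (laurent F).
Implicit Types (f g : K) (M N : int).

Lemma lcoefD f g i : (f + g) i = f i + g i. Proof. by []. Qed.

Lemma lcoefB f g i : (f - g) i = f i - g i. Proof. by []. Qed.

Lemma lcoef0 i : (0 : K) i = 0. Proof. by []. Qed.

Lemma lcoef1 i : (1 : K) i = (i == 0)%:R. Proof. by []. Qed.

Lemma lcoef_sum (I : Type) (r : seq I) (P : pred I) (f : I -> K) k :
  (\sum_(i <- r | P i) f i) k = \sum_(i <- r | P i) f i k.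
Proof. by apply: (big_morph (fun h : K => h k)). Qed.

Lemma lbd0 N : lbd N (0 : K). Proof. by []. Qed.

Lemma lbdD N f g : lbd N f -> lbd N g -> lbd N (f + g).
Proof. by move=> fN gN i Ni /=; rewrite fN// gN// addr0. Qed.

Lemma lbdN N f : lbd N f -> lbd N (- f).
Proof. by move=> fN i Ni /=; rewrite fN// oppr0. Qed.

Lemma lbdB N f g : lbd N f -> lbd N g -> lbd N (f - g).
Proof. by move=> fN gN; apply/lbdD/lbdN. Qed.

Lemma lbd_sum N (I : Type) (r : seq I) (P : pred I) (f : I -> K) :
  (forall i, P i -> lbd N (f i)) -> lbd N (\sum_(i <- r | P i) f i).
Proof. by move=> fN k Nk; rewrite lcoef_sum big1// => i /fN ->. Qed.

Lemma lbdM M N f g : lbd M f -> lbd N g -> lbd (M + N) (f * g).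
Proof. exact: conv_lbd. Qed.

Lemma lbd1 : lbd 0 (1 : K).
Proof. by move=> i i0; rewrite lcoef1 gt_eqF. Qed.

Lemma lbd_pred N f : lbd N f -> f N = 0 -> lbd (N - 1) f.
Proof.
move=> fN fN0 i Ni; have [->//|] := eqVneq i N; move=> iN; apply: fN; lia.
Qed.

Lemma lcoefM_lead M N f g : lbd M f -> lbd N g -> (f * g) (M + N) = f M * g N.
Proof.
move=> fM gN; have := convE 0 fM gN; rewrite !subr0 => e.
by rewrite [LHS]e big_ord1 /= !subr0.
Qed.

Lemma lcoef_signM (b : bool) f i : ((-1) ^+ b * f) i = (-1) ^+ b * f i.
Proof. by case: b; rewrite ?expr1 ?expr0 ?mul1r ?mulN1r. Qed.

Lemma lead_prod (I : finType) (N : I -> int) (f : I -> K) :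
  (forall i, lbd (N i) (f i)) ->
  lbd (\sum_i N i) (\prod_i f i) /\ (\prod_i f i) (\sum_i N i) = \prod_i f i (N
    i).
Proof.
move=> fN; elim/big_ind3: _ => [|a p b a' p' b' [pa ea] [pa' ea']|//].
  by split; [exact: lbd1|rewrite lcoef1].
by split; [exact: lbdM|rewrite lcoefM_lead// ea ea'].
Qed.

(** Each Leibniz term takes one entry from every column, so its degree is at most [\sum_j N j] and
    its coefficient there is the product of the coefficients of the entries in degrees [N j]. *)
Lemma lead_det n (N : 'I_n -> int) (A : 'M[K]_n) :
  (forall i j, lbd (N j) (A i j)) ->
  lbd (\sum_j N j) (\det A) /\
  (\det A) (\sum_j N j) = \det (\matrix_(i, j) A i j (N j)).
Proof.
move=> AN; have lead (s : 'S_n) : lbd (\sum_j N j) (\prod_i A i (s i)) /\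
    (\prod_i A i (s i)) (\sum_j N j) = \prod_i A i (s i) (N (s i)).
  have := @lead_prod _ (N \o s) (fun i => A i (s i)) (fun i => AN i (s i)).
  by rewrite (_ : \sum_i (N \o s) i = \sum_j N j) //= [RHS](reindex_perm s).
split=> [|].
  apply: lbd_sum => s _; have [b _] := lead s.
  by case: odd_perm; rewrite ?expr1 ?expr0 ?mul1r// mulN1r; exact: lbdN.
rewrite lcoef_sum; apply: eq_bigr => s _; have [_ e] := lead s.
rewrite lcoef_signM e; congr (_ * _); apply: eq_bigr => i _.
by rewrite mxE.
Qed.

(** Coefficients of the monomial [x ^ d], for [d] of either sign. *)
Definition mono_fun (d i : int) : F := (i == d)%:R.

Lemma mono_bounded d : exists N, lbd N (mono_fun d).
Proof. by exists d => i di; rewrite /mono_fun gt_eqF. Qed.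

Definition mono (d : int) : K := Laurent (mono_bounded d).

Lemma lbd_mono d : lbd d (mono d).
Proof. by move=> i di /=; rewrite /mono_fun gt_eqF. Qed.

Lemma lcoef_monoM d f i : (mono d * f) i = f (i - d).
Proof.
rewrite /= /Defs.conv (@fsbigE _ _ _ _ _ [:: d])//=.
  by rewrite big_mkcond big_seq1/= in_setT /mono_fun eqxx mul1r.
by move=> j _; rewrite inE /mono_fun => /negPf ->; rewrite mul0r.
Qed.

Lemma mono0 : mono 0 = 1. Proof. by apply: laurentP. Qed.

Lemma monoD d e : mono (d + e) = mono d * mono e.
Proof.
apply: laurentP => i; rewrite lcoef_monoM /= /mono_fun.
by congr (_%:R); congr nat_of_bool; apply/eqP/eqP; lia.
Qed.

Lemma mono_prod (I : finType) (d : I -> int) :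
  \prod_i mono (d i) = mono (\sum_i d i).
Proof. by rewrite (big_morph mono monoD mono0). Qed.

Lemma monoK d : mono d * mono (- d) = 1.
Proof. by rewrite -monoD subrr mono0. Qed.

Lemma monoNK d : mono (- d) * mono d = 1.
Proof. by rewrite -monoD addNr mono0. Qed.

Definition lpolynomial (f : K) := forall i : int, i < 0 -> f i = 0.

(** Every series is bounded above in degree, so vanishing in negative degrees leaves finitely many
    coefficients. *)
Lemma range_lpolyP f : range (@lpoly F) f <-> lpolynomial f.
Proof.
split=> [[p _ <-] [i|i]//|fp]; have [N fN] := lcoef_bounded f.
exists (\poly_(i < `|N|.+1) f i%:Z) => //; apply: laurentP => -[k|k] /=;
  last first.
  by rewrite fp.
rewrite coef_poly; case: ltnP => // kN; rewrite fN//; lia.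
Qed.

Lemma lpolynomial0 : lpolynomial 0. Proof. by []. Qed.

Lemma lpolynomial1 : lpolynomial 1.
Proof. by move=> i i0; rewrite lcoef1 lt_eqF. Qed.

Lemma lpolynomialD f g : lpolynomial f -> lpolynomial g -> lpolynomial (f + g).
Proof. by move=> fp gp i i0 /=; rewrite fp// gp// addr0. Qed.

Lemma lpolynomialN f : lpolynomial f -> lpolynomial (- f).
Proof. by move=> fp i i0 /=; rewrite fp// oppr0. Qed.

Lemma lpolynomialM f g : lpolynomial f -> lpolynomial g -> lpolynomial (f * g).
Proof.
move=> fp gp k k0 /=; rewrite /Defs.conv fsbig1// => i _.
have [i0|i0] := ltP i 0; first by rewrite fp// mul0r.
by rewrite gp ?mulr0//; lia.
Qed.

Lemma lpolynomial_sum (I : Type) (r : seq I) (P : pred I) (f : I -> K) :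
  (forall i, P i -> lpolynomial (f i)) -> lpolynomial (\sum_(i <- r | P i) f i).
Proof.
by move=> fp; elim/big_ind: _ => //; exact: lpolynomialD.
Qed.

Lemma lpolynomial_prod (I : Type) (r : seq I) (P : pred I) (f : I -> K) :
  (forall i, P i -> lpolynomial (f i)) ->
    lpolynomial (\prod_(i <- r | P i) f i).
Proof.
move=> fp; elim/big_ind: _ => //; first exact: lpolynomial1.
exact: lpolynomialM.
Qed.

Lemma lpolynomial_mono d : 0 <= d -> lpolynomial (mono d).
Proof. by move=> d0 i i0 /=; rewrite /mono_fun lt_eqF//; lia. Qed.

Lemma lpolynomial_det n (A : 'M[K]_n) :
  (forall i j, lpolynomial (A i j)) -> lpolynomial (\det A).
Proof.
move=> Ap; apply: lpolynomial_sum => s _.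
have := @lpolynomial_prod 'I_n (index_enum _) xpredT (fun i => A i (s i))
  (fun i _ => Ap i (s i)).
by case: odd_perm; rewrite ?expr1 ?expr0 ?mul1r// mulN1r; exact: lpolynomialN.
Qed.

Definition lconst (a : F) : K := lpoly a%:P.

Lemma lcoef_const a i : lconst a i = if i == 0 then a else 0.
Proof. by case: i => [[|i]|i] //=; rewrite coefC. Qed.

Lemma lbd_const a : lbd 0 (lconst a).
Proof. by move=> i i0; rewrite lcoef_const gt_eqF. Qed.

Lemma lpolynomial_const a : lpolynomial (lconst a).
Proof. by apply/range_lpolyP; exists a%:P. Qed.

Lemma lcoef_constM a f i : (lconst a * f) i = a * f i.
Proof.
rewrite [LHS](_ : _ = Defs.conv (lconst a) f i)// /Defs.conv (@fsbigE _ _ _ _ _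
  [:: 0])//.
  by rewrite big_mkcond big_seq1 in_setT subr0 lcoef_const.
by move=> j _; rewrite inE lcoef_const => /negPf ->; rewrite mul0r.
Qed.

Lemma lconst0 : lconst 0 = 0.
Proof. by apply: laurentP => i; rewrite lcoef_const; case: eqP. Qed.
Lemma lconst1 : lconst 1 = 1.
Proof. by apply: laurentP => i; rewrite lcoef_const lcoef1; case: eqP. Qed.
Lemma lconstD : {morph lconst : a b / a + b}.
Proof.
move=> a b; apply: laurentP => i; rewrite lcoefD !lcoef_const.
by case: eqP; rewrite ?addr0.
Qed.
Lemma lconstM : {morph lconst : a b / a * b}.
Proof.
move=> a b; apply: laurentP => i; rewrite lcoef_constM !lcoef_const.
by case: eqP; rewrite ?mulr0.
Qed.

Fact lconst_is_nmod : GRing.nmod_morphism lconst.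
Proof. by split; [exact: lconst0|exact: lconstD]. Qed.
Fact lconst_is_monoid : GRing.monoid_morphism lconst.
Proof. by split; [exact: lconst1|exact: lconstM]. Qed.
HB.instance Definition _ :=
  GRing.isNmodMorphism.Build F K lconst lconst_is_nmod.
HB.instance Definition _ :=
  GRing.isMonoidMorphism.Build F K lconst lconst_is_monoid.

End Series.

(** * The absolute value *)

Section Absv.
Variable F : finFieldType.
Local Notation K := (laurent F).
Implicit Types (f g : K) (N : int).

Let q1 : 1 < #|F|%:R :> rat. Proof. by rewrite ltr1n card_finNzRing_gt1. Qed.

Lemma absvM f g : absv (f * g) = absv f * absv g.
Proof.
rewrite /absv mulf_eq0; have [//|f0] /= := eqVneq f 0; first by rewrite mul0r.
have [//|g0] /= := eqVneq g 0; first by rewrite mulr0.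
rewrite -expfzDr ?(gt_eqF (lt_trans _ q1))//; congr (_ ^ _).
apply: (@is_ldeg_uniq _ (f * g)); first by apply: ldegP; rewrite mulf_neq0.
have [fd fb] := ldegP f0; have [gd gb] := ldegP g0.
by split; [rewrite lcoefM_lead// mulf_neq0|exact: lbdM].
Qed.

Lemma absv_le f N : reflect (lbd N f) (absv f <= #|F|%:R ^ N).
Proof.
have E : (absv f <= #|F|%:R ^ N) = (absv (f - 0) < #|F|%:R ^ (N + 1)).
  rewrite subr0 /absv; case: eqP => _.
    by rewrite exprz_ge0 ?(ltW (lt_trans _ q1))// exprz_gt0 ?(lt_trans _ q1).
  by rewrite ler_eXz2l// ltr_eXz2l// ltzD1.
rewrite E; apply: (iffP (absv_ltP _ _ _)) => fN i Ni; first by rewrite fN//;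
  lia.
by rewrite fN//; lia.
Qed.

Lemma absv_ge f N : f N != 0 -> #|F|%:R ^ N <= absv f.
Proof.
move=> fN; rewrite leNgt; apply/negP;
  rewrite -[f]subr0 => /absv_ltP /(_ N (lexx _)).
by move=> /= e; move: fN; rewrite e eqxx.
Qed.

Lemma absv_eq1 f : absv f = 1 <-> f 0 != 0 /\ lbd 0 f.
Proof.
split=> [f1|[f0 fb]]; last first.
  by apply/eqP; rewrite eq_le -[1](expr0z #|F|%:R); apply/andP; split;
    [exact/absv_le|exact: absv_ge].
have fb : lbd 0 f by apply/absv_le; rewrite f1 expr0z.
(* With [f 0 = 0] the degree bound drops to -1, and the norm would be at most [q ^ -1 < 1]. *)
split=> //; apply/eqP => f0; have := lbd_pred fb f0; move=> /absv_le.
by rewrite f1 sub0r leNgt invr_lt1 ?unitfE ?q1// ?(gt_eqF (lt_trans _ q1))//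
  (lt_trans _ q1).
Qed.

Lemma absvV_eq1 f : absv f = 1 -> absv f^-1 = 1.
Proof.
move=> f1; have := absvM f f^-1; rewrite f1 mul1r mulfV ?absv1//.
by apply/eqP => f0; move: f1; rewrite f0 /absv eqxx.
Qed.

Lemma lpolynomial_absv f : lpolynomial f -> f != 0 -> 1 <= absv f.
Proof.
move=> fp f0; have [fd _] := ldegP f0.
have /absv_ge := fd; apply: le_trans; rewrite -[1](expr0z #|F|%:R) ler_eXz2l//.
by rewrite leNgt; apply/negP => /fp; exact/eqP.
Qed.

End Absv.

(** * Reduced bases of lattices *)

Section Reduction.
Variables (F : finFieldType) (n : nat).
Local Notation K := (laurent F).
Implicit Types (g h u : 'M[K]_n) (d : 'I_n -> int) (C : 'M[F]_n).

Definition polymx p (A : 'M[K]_(n, p)) := forall i j, lpolynomial (A i j).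

Lemma polymx_mul p g (A : 'M[K]_(n, p)) : polymx g -> polymx A ->
    polymx (g *m A).
Proof.
by move=> gp Ap i j; rewrite mxE; apply: lpolynomial_sum => l _;
  exact: lpolynomialM.
Qed.

(** The two determinants are nonzero polynomials, so both norms are at least 1, and their product is
    1. *)
Lemma GammaI g h : polymx g -> polymx h -> g *m h = 1%:M -> Gamma g.
Proof.
move=> gp hp gh; have [gu hu] := mulmx1_unit gh.
have gh1 : invmx g = h by rewrite -[RHS](mulKmx gu) gh mulmx1.
split; first split=> //.
  by move=> i j; rewrite gh1; split; apply/range_lpolyP.
have g1 : 1 <= absv (\det g).
  by apply: lpolynomial_absv; [exact: lpolynomial_det|rewrite -unitfE].
have h1 : 1 <= absv (\det h).
  by apply: lpolynomial_absv; [exact: lpolynomial_det|rewrite -unitfE].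
apply/eqP; rewrite eq_le g1 andbT.
have <- : absv (\det g) * absv (\det h) = 1.
  by rewrite -absvM -det_mulmx gh det1 absv1.
by rewrite ler_peMr// (le_trans _ g1).
Qed.

Lemma Gamma_poly g : Gamma g -> polymx g.
Proof. by move=> [[_ gp] _] i j; apply/range_lpolyP; have [] := gp i j. Qed.

Lemma Gamma_unit g : Gamma g -> g \in unitmx. Proof. by move=> [[]]. Qed.

Lemma Gamma_det g : Gamma g -> absv (\det g) = 1. Proof. by move=> []. Qed.

Lemma Gamma_inv g : Gamma g -> Gamma (invmx g).
Proof.
move=> gG; apply: (@GammaI _ g); last by rewrite mulVmx// Gamma_unit.
  by have [[_ gp] _] := gG => i j; apply/range_lpolyP; have [] := gp i j.
exact: Gamma_poly.
Qed.

Lemma Gamma_mul g h : Gamma g -> Gamma h -> Gamma (g *m h).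
Proof.
move=> gG hG; apply: (@GammaI _ (invmx h *m invmx g)).
- by apply: polymx_mul; exact: Gamma_poly.
- by apply: polymx_mul; apply: Gamma_poly; exact: Gamma_inv.
by rewrite mulmxA -(mulmxA g) mulmxV ?Gamma_unit// mulmx1 mulmxV ?Gamma_unit.
Qed.

Lemma Gamma1 : Gamma (1%:M : 'M[K]_n).
Proof.
apply: (@GammaI _ 1%:M); rewrite ?mulmx1// => i j; rewrite mxE;
  by case: eqP => _; rewrite ?mulr1n ?mulr0n//; exact: lpolynomial1.
Qed.

(** The determinant is a nonzero constant, possibly different from 1, which the convention
    [|det| = 1] admits. *)
Lemma Gamma_const C : C \in unitmx -> Gamma (map_mx (@lconst F) C).
Proof.
move=> Cu; apply: (@GammaI _ (map_mx (@lconst F) (invmx C))).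
- by move=> i j; rewrite mxE; exact: lpolynomial_const.
- by move=> i j; rewrite mxE; exact: lpolynomial_const.
by rewrite -map_mxM mulmxV// map_mx1.
Qed.

(** A determinant of norm 1 has a nonzero coefficient in degree 0, so its degree bound from
    [lead_det] cannot be negative. *)
Lemma lbd_sum_ge0 g d : absv (\det g) = 1 ->
  (forall i j, lbd (d j) (g i j)) -> 0 <= \sum_j d j.
Proof.
move=> /absv_eq1[g0 _] /lead_det[gd _].
by rewrite leNgt; apply/negP => /gd/eqP; exact/negP.
Qed.

(** The determinant of the leading matrix is the coefficient of [\det g] in degree [\sum_j d j];
    norm 1 makes it vanish if that degree is positive. *)
Lemma lbd_sum_eq0 g d : absv (\det g) = 1 ->
  (forall i j, lbd (d j) (g i j)) ->
  (\matrix_(i, j) g i j (d j)) \in unitmx -> \sum_j d j = 0.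
Proof.
move=> g1 gd; rewrite unitmxE unitfE => C0.
apply/eqP; rewrite eq_le (lbd_sum_ge0 g1 gd) andbT.
have [_ e] := lead_det gd; move: C0; rewrite -e.
move: g1 => /absv_eq1[_ gb]; apply: contraR; rewrite -ltNge.
by move=> /gb ->.
Qed.

(* A vector in the kernel of the matrix of leading coefficients gives a
   polynomial column operation that lowers the degree of one column. *)
Lemma lower_column_degree g d : (forall i j, lbd (d j) (g i j)) ->
  (\matrix_(i, j) g i j (d j)) \notin unitmx ->
  exists2 gamma, Gamma gamma &
    exists j0, forall i j, lbd (d j - (j == j0)%:R) ((g *m gamma) i j).
Proof.
move=> gd; set C := (\matrix_(i, j) _).
rewrite unitmxE unitfE negbK -det_tr => /det0P[v v0 vC].
have [l0 vl0] : exists l, v 0 l != 0.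
  by apply/existsP; apply: contraR v0 => /existsPn vl; apply/eqP/rowP => l;
    rewrite mxE; have := vl l; rewrite negbK => /eqP.
(* Among the columns in the linear relation, the one of largest degree is lowered, so that the
   exponents [d j0 - d l] below are nonnegative. *)
case: (@arg_maxP _ _ _ l0 (fun l => v 0 l != 0) d vl0) => j0 vj0 maxj0.
pose c l := v 0 l / v 0 j0.
have Cc i : \sum_l C i l * c l = 0.
  have /rowP/(_ i) := vC; rewrite [LHS]mxE [RHS]mxE => e.
  rewrite (eq_bigr (fun l => (v 0 l * C^T l i) / v 0 j0)); last first.
    by move=> l _; rewrite /c [C^T l i]mxE mulrCA mulrA.
  by rewrite -mulr_suml e mul0r.
(* The entry of [w] at [j0] is 0, so [w *m e] has square zero and [1 - w *m e] inverts
   [1 + w *m e]. *)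
pose w : 'cV[K]_n :=
  \col_l if l == j0 then 0 else lconst (c l) * mono F (d j0 - d l).
pose e : 'rV[K]_n := delta_mx 0 j0.
have wp i j : lpolynomial ((w *m e) i j).
  rewrite mxE; apply: lpolynomial_sum => k _; apply: lpolynomialM; rewrite !mxE.
    case: eqP => // _; have [cl|cl] := eqVneq (v 0 i) 0.
      by rewrite /c cl mul0r lconst0 mul0r.
    apply: lpolynomialM; first exact: lpolynomial_const.
    by apply: lpolynomial_mono; have := maxj0 i cl; rewrite /=; lia.
  by case: (_ && _) => //; exact: lpolynomial1.
have ew : e *m w = 0.
  apply/matrixP => i j; rewrite !mxE (bigD1 j0)//= big1 ?addr0.
    by rewrite !mxE eqxx mulr0.
  by move=> l /negPf lj; rewrite !mxE lj andbF mul0r.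
exists (1%:M + w *m e).
  apply: (@GammaI _ (1%:M - w *m e)).
  - move=> i j; rewrite mxE; apply: lpolynomialD => //.
    exact: (Gamma_poly Gamma1).
  - move=> i j; rewrite mxE; apply: lpolynomialD;
    first exact: (Gamma_poly Gamma1).
    by rewrite mxE; exact: lpolynomialN.
  rewrite mulmxDl mul1mx mulmxDr mulmx1 mulmxN -mulmxA (mulmxA e) ew mul0mx
    mulmx0.
  by rewrite subr0 subrK.
exists j0 => i j.
have gwe : (g *m (1%:M + w *m e)) i j = g i j + (g *m w) i 0 * (j == j0)%:R.
  rewrite mulmxDr mulmx1 mxE mulmxA; congr (_ + _).
  by rewrite mxE big_ord1 [e _ _]mxE eqxx.
rewrite gwe; have [->{j gwe}|jj0] := eqVneq j j0; last by rewrite mulr0 !addr0.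
have gwb l : lbd (d j0) (g i l * w l 0).
  rewrite mxE; case: eqP => _; first by rewrite mulr0; exact: lbd0.
  apply: (@lbdW _ (d l + (0 + (d j0 - d l)))); first by lia.
  by apply: lbdM => //; apply: lbdM; [exact: lbd_const|exact: lbd_mono].
rewrite mulr1; apply: lbd_pred.
  by apply: lbdD => //; rewrite mxE; exact: lbd_sum.
(* In degree [d j0] the new column has coefficient [\sum_l C i l * c l] with [c j0 = 1], which is 0
   by the relation. *)
rewrite lcoefD [(g *m w) i 0]mxE lcoef_sum.
rewrite (eq_bigr (fun l => if l == j0 then 0 else C i l * c l)).
  rewrite -[RHS](Cc i) (bigD1 j0)//= [in RHS](bigD1 j0)//= eqxx add0r.
  congr (_ + _); first by rewrite mxE /c mulfV// mulr1.
  by apply: eq_bigr => l /negPf ->.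
move=> l _; rewrite [w l 0]mxE; case: eqP => _; first by rewrite mulr0.
rewrite mulrCA lcoef_constM mulrC [in RHS]mxE; congr (_ * _).
by rewrite mulrC lcoef_monoM; congr (g i l _); lia.
Qed.

(** Induction on the total degree [\sum_j d j]: a singular leading matrix allows it to drop by 1,
    and it never becomes negative. *)
Lemma column_reduced g : absv (\det g) = 1 ->
  exists gamma d, [/\ Gamma gamma, forall i j, lbd (d j) ((g *m gamma) i j),
    (\matrix_(i, j) (g *m gamma) i j (d j)) \in unitmx & \sum_j d j = 0].
Proof.
move=> g1.
have detg gamma : Gamma gamma -> absv (\det (g *m gamma)) = 1.
  by move=> gG; rewrite det_mulmx absvM g1 mul1r Gamma_det.
suff red (N : nat) gamma d : Gamma gamma ->
    (forall i j, lbd (d j) ((g *m gamma) i j)) -> \sum_j d j = N%:Z ->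
    exists gamma d, [/\ Gamma gamma, forall i j, lbd (d j) ((g *m gamma) i j),
    (\matrix_(i, j) (g *m gamma) i j (d j)) \in unitmx & \sum_j d j = 0].
  have [f fP] := @choice _ _ (fun ij N => lbd N (g ij.1 ij.2))
    (fun ij => lcoef_bounded (g ij.1 ij.2)).
  pose d (j : 'I_n) : int := \sum_(i < n) `|f (i, j)|.
  have gd i j : lbd (d j) ((g *m 1%:M) i j).
    rewrite mulmx1; apply: lbdW (fP (i, j)).
    by rewrite /d (bigD1 i)//= (le_trans (ler_norm _))// lerDl sumr_ge0.
  have d0 : 0 <= \sum_j d j by apply: sumr_ge0 => j _; exact: sumr_ge0.
  by apply: (red (absz (\sum_j d j)) _ _ Gamma1 gd); rewrite gez0_abs.
elim: N gamma d => [|N IHN] gamma d gG gd dN.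
all: have [Cu|] := boolP ((\matrix_(i, j) (g *m gamma) i j (d j)) \in unitmx);
  first by exists gamma, d; split=> //; exact: lbd_sum_eq0 (detg _ gG) gd Cu.
all: move=> /(lower_column_degree gd)[gamma' gG'] [j0]; rewrite -mulmxA => gd'.
all: have dN' : \sum_j (d j - (j == j0)%:R) = \sum_j d j - 1
  by rewrite sumrB; congr (_ - _);
    rewrite (bigD1 j0)//= eqxx big1 ?addr0// => j /negPf ->.
  (* From total degree 0 a further drop would give -1. *)
  have := lbd_sum_ge0 (detg _ (Gamma_mul gG gG')) gd'.
  by rewrite dN' dN.
apply: (IHN _ _ (Gamma_mul gG gG') gd').
by rewrite dN' dN; lia.
Qed.

(* The kernel of the reduction modulo [x^-1] on GL_n of the valuation ring. *)
Definition U1 u := forall i j, lbd (-1) ((u - 1%:M) i j).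

Lemma U1_lbd u : U1 u -> forall i j, lbd 0 (u i j).
Proof.
move=> uU i j; rewrite -[u](subrK 1%:M) mxE; apply: lbdD.
  exact: (@lbdW _ (-1)).
rewrite mxE; case: eqP => _; [exact: lbd1|exact: lbd0].
Qed.

Lemma U1_coef u i j k : U1 u -> 0 <= k -> u i j k = ((i == j) && (k == 0))%:R.
Proof.
move=> uU k0; rewrite -[u](subrK 1%:M) mxE lcoefD uU ?add0r; last by lia.
by rewrite mxE; case: eqP.
Qed.

Lemma U1I u : (forall i j, lbd 0 (u i j)) ->
  (forall i j, u i j 0 = (i == j)%:R) -> U1 u.
Proof.
move=> ub u0 i j; rewrite -[-1](add0r (-1)); apply: lbd_pred.
  rewrite !mxE; apply: lbdB; first exact: ub.
  by case: eqP => _; [exact: lbd1|exact: lbd0].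
rewrite !mxE lcoefB u0; case: eqP => _; last exact: subrr.
exact: subrr.
Qed.

(** The matrix [u - 1] lowers degrees, so [u] preserves the top coefficients of a vector. *)
Lemma U1_lead u (y : 'cV[K]_n) M : U1 u -> (forall i, lbd M (y i 0)) ->
  forall i, lbd M ((u *m y) i 0) /\ (u *m y) i 0 M = y i 0 M.
Proof.
move=> uU yM i.
have e : lbd (M - 1) (((u - 1%:M) *m y) i 0).
  rewrite mxE; apply: lbd_sum => j _; rewrite addrC; exact: lbdM.
rewrite -[u](subrK 1%:M) mulmxDl mul1mx mxE; split.
  by apply: lbdD => //; apply: lbdW e; lia.
by rewrite lcoefD e ?add0r//; lia.
Qed.

Lemma lead_col (y : 'cV[K]_n) : y != 0 ->
  exists M l, (forall i, lbd M (y i 0)) /\ y l 0 M != 0.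
Proof.
move=> y0; have [l0 yl0] : exists l, y l 0 != 0.
  by apply/existsP; apply: contraR y0 => /existsPn yl; apply/eqP/colP => l;
    rewrite [RHS]mxE; have := yl l; rewrite negbK => /eqP.
case: (@arg_maxP _ _ _ l0 (fun l => y l 0 != 0) (fun l => ldeg (y l 0)) yl0).
move=> l yl maxl; exists (ldeg (y l 0)), l; split; last by have [] := ldegP yl.
move=> i; have [->|yi] := eqVneq (y i 0) 0; first exact: lbd0.
by have [_ yb] := ldegP yi; apply: lbdW yb; exact: maxl.
Qed.

Lemma U1_det u : U1 u -> absv (\det u) = 1.
Proof.
move=> uU; have [b e] := @lead_det _ n (fun=> 0) u (U1_lbd uU).
rewrite !big1_eq in b e.
apply/absv_eq1; split=> //; rewrite e (_ : \matrix_(_, _) _ = 1%:M).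
  by rewrite det1 oner_eq0.
by apply/matrixP => i j; rewrite !mxE U1_coef// eqxx andbT.
Qed.

Lemma mulmx_col p q r (A : 'M[K]_(p, q)) (B : 'M[K]_(q, r)) j i :
  (A *m col j B) i 0 = (A *m B) i j.
Proof. by rewrite colE mulmxA -colE mxE. Qed.

Lemma unitmx_col_neq0 g j : g \in unitmx -> col j g != 0.
Proof.
move=> gu; apply/eqP => g0; have := mulmx_col (invmx g) g j j.
by rewrite g0 mulmx0 mulVmx// !mxE eqxx => /eqP; rewrite eq_sym oner_eq0.
Qed.

(** Each column of [gamma] has the same top degree and top coefficients as that of [g]. The degree
    is nonnegative for a polynomial column, hence 0 as [g] is in [U1], and the coefficients are
    those of the identity. *)
Lemma U1_Gamma h g gamma : U1 h -> U1 g -> Gamma gamma ->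
  h *m gamma = g -> gamma = 1%:M.
Proof.
move=> hU gU gG hg; apply/matrixP => i j.
have [M [l [cM cl]]] := lead_col (unitmx_col_neq0 j (Gamma_unit gG)).
have gE k : lbd M (g k j) /\ g k j M = gamma k j M.
  by have := U1_lead hU cM k; rewrite mulmx_col hg [col _ _ _ _]mxE.
have M0 : 0 <= M.
  by rewrite leNgt; apply: contra cl => M0; rewrite mxE (Gamma_poly gG).
have {}M0 : M = 0.
  move: cl; rewrite mxE; have [_ <-] := gE l; rewrite U1_coef//.
  by case: (M =P 0) => //; rewrite andbF eqxx.
rewrite M0 in cM gE; apply: laurentP => k.
have [k0|k0|->] := ltgtP k 0.
- rewrite (Gamma_poly gG)// mxE; case: eqP => _ //.
  by rewrite lcoef1 lt_eqF.
- have := cM i k k0; rewrite [col _ _ _ _]mxE => ->.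
  by rewrite mxE; case: eqP => _ //; rewrite lcoef1 gt_eqF.
have [_ <-] := gE i; rewrite U1_coef// eqxx andbT mxE.
by case: eqP.
Qed.

Definition dmono d : 'M[K]_n := diag_mx (\row_j mono F (d j)).

Lemma dmonoMl d p (A : 'M[K]_(n, p)) i j : (dmono d *m A) i j = mono F (d i) *
    A i j.
Proof. by rewrite mul_diag_mx !mxE. Qed.

Lemma dmonoMr d p (A : 'M[K]_(p, n)) i j : (A *m dmono d) i j = A i j * mono F
    (d j).
Proof. by rewrite mul_mx_diag !mxE. Qed.

Definition dmonoV d : 'M[K]_n := dmono (fun j => - d j).

Lemma dmonoVK d : dmonoV d *m dmono d = 1%:M.
Proof.
apply/matrixP => i j; rewrite dmonoMl !mxE; case: eqP => _.
  by rewrite !mulr1n monoNK.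
by rewrite !mulr0n mulr0.
Qed.

Lemma dmonoK d : dmono d *m dmonoV d = 1%:M.
Proof. exact/mulmx1C/dmonoVK. Qed.

Lemma det_dmono d : \det (dmono d) = mono F (\sum_j d j).
Proof. by rewrite det_diag -mono_prod; apply: eq_bigr => i _; rewrite mxE. Qed.

Lemma det_conj_dmono d u : \det (dmonoV d *m u *m dmono d) = \det u.
Proof. by rewrite -mulmxA det_mulmx mulrC -det_mulmx -mulmxA dmonoK mulmx1. Qed.

(** For [i != j] the second condition bounds the degree of [h i j] by [d j - d i - 1]. *)
Definition box d h := U1 h /\ U1 (dmono d *m h *m dmonoV d).

Lemma U1_dmono_lead u d (w : 'cV[K]_n) : U1 u -> w != 0 ->
  exists M l, [/\ forall i, lbd M ((u *m (dmono d *m w)) i 0),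
    forall i, (u *m (dmono d *m w)) i 0 M = w i 0 (M - d i) &
    w l 0 (M - d l) != 0].
Proof.
move=> uU w0; have y0 : dmono d *m w != 0.
  apply: contra_neq w0 => y0.
  by rewrite -[w]mul1mx -(dmonoVK d) -mulmxA y0 mulmx0.
have [M [l [yM yl]]] := lead_col y0.
exists M, l; split.
- by move=> i; have [] := U1_lead uU yM i.
- by move=> i; have [_ ->] := U1_lead uU yM i; rewrite dmonoMl lcoef_monoM.
- by move: yl; rewrite dmonoMl lcoef_monoM.
Qed.

(** Column [j] of [D h = u D gamma] has the top coefficients of column [j] of [D gamma]. These turn
    out to lie in row [j] and degree [d j] only, so the other rows have smaller degree, which is the
    box condition. *)
Lemma box_mul_Gamma u d gamma h : U1 u -> Gamma gamma -> U1 h ->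
  h = dmonoV d *m u *m dmono d *m gamma -> box d h.
Proof.
move=> uU gG hU hE; split=> // i j.
have [M [l [lM eM wl]]] :=
  U1_dmono_lead d uU (unitmx_col_neq0 j (Gamma_unit gG)).
have DhE k : (u *m (dmono d *m col j gamma)) k 0 = mono F (d k) * h k j.
  rewrite -dmonoMl hE 2!(mulmxA (dmono d)) (mulmxA (dmono d)) dmonoK mul1mx.
  by rewrite !colE !mulmxA -colE mxE.
(* A nonzero coefficient of the polynomial [gamma k j] has degree [M - d k >= 0], where [h] agrees
   with the identity. *)
have key k : gamma k j (M - d k) != 0 -> k = j /\ M = d j.
  move=> gk; have Mk : 0 <= M - d k.
    by rewrite leNgt; apply: contra gk => k0; rewrite (Gamma_poly gG).
  have := eM k; rewrite DhE lcoef_monoM mxE (U1_coef _ _ hU Mk) => e.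
  move: gk; rewrite -e; case: (k =P j) => [->|_] /=; last by rewrite eqxx.
  by case: (M - d j =P 0) => [? _|_]; [split=> //; lia|rewrite eqxx].
have [lj Mj] : l = j /\ M = d j by apply: key; move: wl; rewrite mxE.
have [->{i}|ij] := eqVneq i j.
  rewrite mxE dmonoMr dmonoMl mxE mxE eqxx [mono _ _ * _]mulrC -mulrA monoK
    mulr1.
  by have := hU j j; rewrite !mxE eqxx.
rewrite mxE dmonoMr [(- 1%:M) _ _]mxE [1%:M _ _]mxE (negPf ij) oppr0 addr0.
rewrite dmonoMl -DhE (_ : -1 = (d j - 1) + - d j); last by lia.
apply: lbdM; last exact: lbd_mono.
apply: lbd_pred; first by rewrite -Mj.
rewrite -Mj eM mxE; apply/eqP; apply: contraNT ij => /key[-> _] //.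
Qed.

(* The second reduction applies to the conjugate [D^-1 u D]: its lattice has no
   nonzero vector of norm less than 1, so all degrees [d'] vanish. *)
Lemma reduction g : absv (\det g) = 1 ->
  exists C d, [/\ C \in unitmx, \sum_j d j = 0 &
  exists2 h, box d h & exists2 gamma, Gamma gamma &
    g *m gamma = map_mx (@lconst F) C *m dmono d *m h].
Proof.
move=> g1; have [gamma [d [gG gd Cu d0]]] := column_reduced g1.
set C := (\matrix_(i, j) _) in Cu; exists C, d; split=> //.
pose CK := map_mx (@lconst F) C;
  have CKu : CK \in unitmx by exact/Gamma_unit/Gamma_const.
pose CV := map_mx (@lconst F) (invmx C).
have CVC : CV *m CK = 1%:M by rewrite -map_mxM mulVmx// map_mx1.
have CCV : CK *m CV = 1%:M by rewrite -map_mxM mulmxV// map_mx1.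
(* Removing the column degrees and the leading matrix leaves residue 1. *)
pose u := CV *m (g *m gamma) *m dmonoV d.
have uE : CK *m u *m dmono d = g *m gamma.
  by rewrite /u -!mulmxA dmonoVK mulmx1 !mulmxA CCV mul1mx.
have vb i j : lbd 0 ((g *m gamma *m dmonoV d) i j).
  by rewrite dmonoMr -(subrr (d j)); apply: lbdM => //; exact: lbd_mono.
have v0 i j : (g *m gamma *m dmonoV d) i j 0 = C i j.
  by rewrite dmonoMr mulrC lcoef_monoM [RHS]mxE sub0r opprK.
have residue (B : 'M[F]_n) (A : 'M[K]_n) : (forall i j, lbd 0 (A i j)) ->
    forall i j, lbd 0 ((map_mx (@lconst F) B *m A) i j) /\
      (map_mx (@lconst F) B *m A) i j 0 = \sum_l B i l * A l j 0.
  move=> Ab i j; rewrite mxE; split.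
    apply: lbd_sum => l _; rewrite mxE -(addr0 0); apply: lbdM => //;
      exact: lbd_const.
  by rewrite lcoef_sum; apply: eq_bigr => l _; rewrite mxE lcoef_constM.
have uU : U1 u.
  apply: U1I => i j; rewrite /u -mulmxA; have [b e] :=
    residue (invmx C) _ vb i j => //.
  rewrite e; have /matrixP/(_ i j) := mulVmx Cu; rewrite !mxE => <-.
  by apply: eq_bigr => l _; rewrite v0.
have g1' : absv (\det (dmonoV d *m u *m dmono d)) = 1.
  by rewrite det_conj_dmono U1_det.
have [gamma' [d' [gG' gd' Cu' d0']]] := column_reduced g1'.
set B := (_ *m gamma') in gd' Cu'.
(* In column [k], some row [l] of [u D gamma'] has a nonzero top coefficient, equal to that of
   [gamma'] in degree [M - d l >= 0]. So [B l k] is nonzero in that degree and [d' k >= 0]; the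
   [d' k] sum to 0. *)
have d'0 j : d' j = 0.
  suff d'ge k : 0 <= d' k.
    have /eqP := d0'; rewrite psumr_eq0// => /allP/(_ j).
    by rewrite mem_index_enum => /(_ isT)/eqP.
  have [M [l [lM eM wl]]] :=
    U1_dmono_lead d uU (unitmx_col_neq0 k (Gamma_unit gG')).
  have Ml : 0 <= M - d l.
    by rewrite leNgt; apply: contra wl => k0; rewrite mxE (Gamma_poly gG').
  move: wl; rewrite -eM; rewrite leNgt; apply: contra => dk0.
  rewrite (_ : (u *m _) l 0 = mono F (d l) * B l k).
    by rewrite lcoef_monoM gd'//; lia.
  rewrite -dmonoMl /B !(mulmxA (dmono d)) dmonoK mul1mx.
  by rewrite !colE !mulmxA -colE mxE.
set C' := (\matrix_(i, j) _) in Cu'.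
(* As [d' = 0], [C'] is the residue of [B]; dividing by it puts the product in [U1]. *)
pose gamma2 := gamma' *m map_mx (@lconst F) (invmx C').
have gG2 : Gamma gamma2.
  by apply: Gamma_mul => //; apply: Gamma_const; rewrite unitmx_inv.
exists (dmonoV d *m u *m dmono d *m gamma2); last first.
  exists (gamma *m gamma2); first exact: Gamma_mul.
  by rewrite mulmxA -uE !mulmxA -(mulmxA _ (dmono d) (dmonoV d)) dmonoK mulmx1.
apply: (@box_mul_Gamma u _ gamma2) => //.
rewrite /gamma2 mulmxA -/B.
have Bb i j : lbd 0 (B i j) by have := gd' i j; rewrite d'0.
apply: U1I => i j; rewrite mxE.
  apply: lbd_sum => l _; rewrite [X in _ * X]mxE -(addr0 0); apply: lbdM => //.
  exact: lbd_const.
rewrite lcoef_sum; have /matrixP/(_ i j) := mulmxV Cu'; rewrite !mxE => <-.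
by apply: eq_bigr => l _; rewrite !mxE mulrC lcoef_constM mulrC d'0.
Qed.

End Reduction.

(** * Orbits in the space of lattices *)

Section Orbits.
Variables (F : finFieldType) (n : nat).
Local Notation K := (laurent F).
Implicit Types (g h u A B : 'M[K]_n) (d : 'I_n -> int) (X Y : Ln F n).

Lemma mem_SLset g : absv (\det g) = 1 -> SLset setT g.
Proof.
move=> g1; split; last by [].
split=> //; rewrite unitmxE unitfE; apply/eqP => g0.
by move: g1; rewrite g0 /absv eqxx => /eqP; rewrite eq_sym oner_eq0.
Qed.

Definition mkG g (g1 : absv (\det g) = 1) : G F n :=
  SigSub (mem_set (mem_SLset g1)).

Lemma Gval_det (g : G F n) : absv (\det (Gval g)) = 1.
Proof. by have := set_valP g => -[]. Qed.

Lemma Lnval_ex X : exists g : G F n, Lnval X = coset g.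
Proof. by have [g _ gX] := set_valP X; exists g. Qed.

Lemma Lnval_Gamma X A gamma : Lnval X A -> Gamma gamma -> Lnval X (A *m gamma).
Proof.
have [g ->] := Lnval_ex X => -[gamma' gG' <-] gG.
by exists (gamma' *m gamma); [exact: Gamma_mul|rewrite mulmxA].
Qed.

Lemma Lnval_det X A : Lnval X A -> absv (\det A) = 1.
Proof.
have [g ->] := Lnval_ex X => -[gamma gG <-].
by rewrite det_mulmx absvM Gval_det Gamma_det// mulr1.
Qed.

Lemma det1_unitmx A : absv (\det A) = 1 -> A \in unitmx.
Proof. by move=> /mem_SLset[[]]. Qed.

Lemma Lnval_rel X A B : Lnval X A -> Lnval X B ->
  exists2 gamma, Gamma gamma & B = A *m gamma.
Proof.
have [g ->] := Lnval_ex X => -[a aG <-] [b bG <-].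
exists (invmx a *m b); first exact/Gamma_mul/bG/Gamma_inv.
by rewrite !mulmxA mulmxK// Gamma_unit.
Qed.

Lemma Lnval_mem A : absv (\det A) = 1 -> exists X, Lnval X A.
Proof.
move=> A1; exists (piLn (mkG A1)); exists 1%:M; first exact: Gamma1.
exact: mulmx1.
Qed.

Lemma Lnval_translate X Y g : absv (\det g) = 1 -> forall A,
  Lnval X A -> Lnval Y (g *m A) -> Lnval Y = [set g *m h | h in Lnval X].
Proof.
move=> g1 A XA YA; apply/seteqP; split=> [B|_ [B XB <-]].
  move=> /(Lnval_rel YA)[gamma gG ->]; exists (A *m gamma); last exact: mulmxA.
  exact: Lnval_Gamma.
have [gamma gG ->] := Lnval_rel XA XB.
by rewrite mulmxA; exact: Lnval_Gamma.
Qed.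

Definition orb g d : set (Ln F n) :=
  [set X | exists2 h, box d h & Lnval X (g *m h)].

Lemma Ltrans_orb (g : G F n) d : Ltrans g (orb 1%:M d) = orb (Gval g) d.
Proof.
apply/seteqP; split=> [Y [X [h hd XA] YE]|Y [h hd YA]].
  by exists h => //; rewrite YE; exists h => //; rewrite mul1mx in XA.
have h1 : absv (\det h) = 1 by apply: U1_det; have [] := hd.
have [X Xh] := Lnval_mem h1; exists X.
  by exists h => //; rewrite mul1mx.
by apply: (@Lnval_translate _ _ _ (Gval_det g) h).
Qed.

Lemma mx_lbd p q (A : 'M[K]_(p, q)) : exists N : nat, forall i j, lbd N (A i j).
Proof.
have [f fP] := @choice _ _ (fun ij N => lbd N (A ij.1 ij.2))
  (fun ij => lcoef_bounded (A ij.1 ij.2)).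
exists (\sum_ij absz (f ij))%N => i j; apply: lbdW (fP (i, j)).
by rewrite (bigD1 (i, j))//=; lia.
Qed.

(** If [L] and [R] have degrees at most [M] and [N], a change of [A] of degree below [- (M + N)]
    changes the product in degrees at most -1 only. *)
Lemma U1_sandwich (L A R : 'M[K]_n) : U1 (L *m A *m R) ->
  exists N, forall A', (forall i j, lball (A i j) N (A' i j)) ->
    U1 (L *m A' *m R).
Proof.
move=> AU; have [M LM] := mx_lbd L; have [N RN] := mx_lbd R.
exists (- (M%:Z + N%:Z)) => A' AA'.
have -> : A' = A + (A' - A) by rewrite addrC subrK.
have Db i j : lbd (- (M%:Z + N%:Z) - 1) ((A' - A) i j).
  by move=> k kN; rewrite !mxE lcoefB AA' ?subrr//; lia.
rewrite mulmxDr mulmxDl => i j; rewrite addrAC mxE; apply: lbdD;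
  first exact: AU.
rewrite mxE; apply: lbd_sum => l _.
rewrite mxE mulr_suml; apply: lbd_sum => k _.
rewrite (_ : -1 = M%:Z + (- (M%:Z + N%:Z) - 1) + N%:Z); last by lia.
by apply: lbdM => //; exact: lbdM.
Qed.

Lemma orb_open g d : absv (\det g) = 1 -> open (orb g d).
Proof.
move=> g1; have gu := det1_unitmx g1.
(* The preimage of the orbit in the group is the trace of this set of matrices, a union of sets cut
   out by two open conditions. *)
pose O : set 'M[K]_n := \bigcup_(gamma in @Gamma F n)
  [set A | box d (invmx g *m A *m gamma)].
have oO : open O.
  apply: bigcup_open => gamma gG; rewrite openE => A [].
  move=> /U1_sandwich[N1 N1P].
  rewrite 2!(mulmxA (dmono F d)) -(mulmxA (_ *m A)) => /U1_sandwich[N2 N2P].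
  pose N := Num.min N1 N2.
  exists (fun i j => lball (A i j) N); first by move=> i j; exists N.
  move=> A' /= AA'; split.
    apply: N1P => i j k Nk; apply: AA'; apply: le_trans Nk.
    by rewrite ge_min lexx.
  rewrite 2!(mulmxA (dmono F d)) -(mulmxA (_ *m A')).
  apply: N2P => i j k Nk; apply: AA'; apply: le_trans Nk.
  by rewrite ge_min lexx orbT.
have -> : open (orb g d) = Ln_open (orb g d) by [].
rewrite /Ln_open (_ : _ @^-1` _ = @Gval F n @^-1` O); last first.
  apply/seteqP; split=> [a [h hd [gamma gG e]]|a [gamma gG ad]].
    by exists gamma => //=; rewrite -mulmxA e mulKmx.
  exists (invmx g *m Gval a *m gamma) => //.
  by exists gamma => //; rewrite !mulmxA mulmxV// mul1mx.
by apply: open_comp => // a _; exact: initial_continuous.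
Qed.

Lemma U1_mul u h : U1 u -> U1 h -> U1 (u *m h).
Proof.
move=> uU hU; have e : u *m h - 1%:M = (u - 1%:M) *m h + (h - 1%:M).
  by rewrite mulmxBl mul1mx addrA subrK.
move=> i j; rewrite e mxE; apply: lbdD => //; rewrite mxE;
  apply: lbd_sum => l _.
by rewrite -(addr0 (-1)); apply: lbdM => //; exact: U1_lbd.
Qed.

(* The matrices [Z] of the introduction. *)
Definition thin d A := forall i j k, A i j k != 0 ->
  [/\ d j < 0, 0 <= d i, d j - d i <= k & k < 0].

Lemma thinB d A B : thin d A -> thin d B -> thin d (A - B).
Proof.
move=> Ad Bd i j k; rewrite !mxE lcoefB => ABk.
have [A0|/Ad//] := eqVneq (A i j k) 0; apply: Bd.
by apply: contra_neq ABk => ->; rewrite A0 subr0.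
Qed.

Lemma thin_neq0 d A i j : thin d A -> A i j != 0 -> d j < 0 <= d i.
Proof. by move=> Ad /ldegP[/Ad[-> ->]]. Qed.

(** A nonzero entry has [d < 0] at its column and [d >= 0] at its row, so no two nonzero entries can
    be chained. Hence [(1 + A) (1 + B) = 1 + A + B]. *)
Lemma thin_mul0 d A B : thin d A -> thin d B -> A *m B = 0.
Proof.
move=> Ad Bd; apply/matrixP => i j; rewrite mxE [RHS]mxE big1// => l _.
have [->|/(thin_neq0 Ad)/andP[dl _]] := eqVneq (A i l) 0; first exact: mul0r.
have [->|/(thin_neq0 Bd)/andP[_]] := eqVneq (B l j) 0; first exact: mulr0.
by rewrite leNgt dl.
Qed.

Lemma thin_U1 d A : thin d A -> U1 (1%:M + A).
Proof.
move=> Ad i j; rewrite addrAC subrr add0r => k k0; apply/eqP.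
by apply: contraT => /Ad[_ _ _]; lia.
Qed.

(* The entries of [A] outside the box are too large to be compensated by the
   off-diagonal entries of [h], [h']. *)
Lemma thin_box d A h h' : thin d A -> box d h -> box d h' ->
  (1%:M + A) *m h' = h -> A = 0.
Proof.
move=> Ad [_ hd] [_ hd'] hE.
pose V := dmono F d *m A *m dmonoV F d; pose u := dmono F d *m h' *m dmonoV F d.
have Vu i j : lbd (-1) ((V *m u) i j).
  have -> : V *m u = (dmono F d *m h *m dmonoV F d - 1%:M) - (u - 1%:M).
    rewrite opprB addrA subrK /V /u -hE mulmxDl mul1mx mulmxDr mulmxDl.
    rewrite addrAC subrr add0r !mulmxA -(mulmxA _ (dmonoV F d) (dmono F d)).
    by rewrite dmonoVK mulmx1.
  by rewrite mxE; apply: lbdD => //; rewrite mxE; exact: lbdN.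
have VE i j k : V i j k = A i j (k - d i + d j).
  rewrite /V dmonoMr dmonoMl mulrC lcoef_monoM mulrC.
  by rewrite mulrC lcoef_monoM; congr (A i j _); lia.
apply/matrixP => i j; rewrite [RHS]mxE; apply/eqP; apply: contraT => Aij.
have rowT (W : 'M[K]_n) k : (row i W)^T k 0 = W i k by rewrite mxE mxE.
have y0 : (row i V)^T != 0.
  have [a _] := ldegP Aij; apply: contraTneq a => /colP/(_ j).
  rewrite rowT [RHS]mxE => Vij; have := VE i j (ldeg (A i j) + d i - d j).
  rewrite Vij lcoef0 => e; rewrite negbK; apply/eqP; rewrite [RHS]e.
  by congr (A i j _); lia.
have [M [l [yM yl]]] := lead_col y0.
have uT : U1 u^T.
  by move=> a b; rewrite -trmx1 -linearB /= mxE; exact: hd'.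
(* Right multiplication by [u] keeps the top coefficients, in degree [M], of row [i] of [V].
   Thinness of [A] gives [M >= 0], against the degree bound -1 for [V *m u]. *)
have [_] := U1_lead uT yM l.
rewrite -trmx_mul -row_mul !rowT Vu => [e|]; first by move: yl;
  rewrite rowT -e eqxx.
by move: yl; rewrite rowT VE => /Ad[_ _]; lia.
Qed.

(** A common lattice gives [h gamma = (1 + (B - A)) h']. Both [h] and the right side are in [U1], so
    [gamma = 1], and [thin_box] applies to [B - A]. *)
Lemma orb_disjoint d A B : thin d A -> thin d B ->
  orb (1%:M + A) d `&` orb (1%:M + B) d !=set0 -> A = B.
Proof.
move=> Ad Bd [X [[h hd XA] [h' hd' XB]]].
have [gamma gG e] := Lnval_rel XA XB.
have BAd := thinB Bd Ad.
have e' : h *m gamma = (1%:M + (B - A)) *m h'.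
  have -> : 1%:M + (B - A) = (1%:M - A) *m (1%:M + B).
    by rewrite mulmxDr mulmx1 mulmxBl mul1mx (thin_mul0 Ad Bd) subr0 addrAC
      addrA.
  rewrite -mulmxA e !mulmxA; congr (_ *m _); rewrite -[LHS]mul1mx;
    congr (_ *m _).
  by rewrite mulmxDr mulmx1 mulmxBl mul1mx (thin_mul0 Ad Ad) subr0 subrK.
have g1 : gamma = 1%:M.
  have [hU _] := hd; have [hU' _] := hd'.
  by apply: (U1_Gamma hU _ gG e'); apply: U1_mul => //; exact: thin_U1 BAd.
apply/eqP; rewrite eq_sym -subr_eq0; apply/eqP.
by apply: (thin_box BAd hd hd'); rewrite -e' g1 mulmx1.
Qed.

End Orbits.

(** * Measure of the orbits *)

Section OrbitMeasure.
Variables (F : finFieldType) (n : nat).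
Local Notation K := (laurent F).
Implicit Types (g : 'M[K]_n) (d : 'I_n -> int).

(** The number [s] of the introduction. *)
Definition depth d : nat := (\sum_(i | (d i < 0)%R) absz (d i))%N.

Lemma depth_nonneg d : \sum_i d i = 0 ->
  (\sum_(i | ~~ (d i < 0)%R) absz (d i))%N = depth d.
Proof.
move=> d0; apply/eqP; rewrite -eqz_nat; apply/eqP.
have e : \sum_(i | d i < 0) d i = - (depth d)%:Z.
  rewrite /depth (big_morph Posz PoszD (erefl _)) -sumrN.
  by apply: eq_bigr => i; lia.
rewrite (big_morph Posz PoszD (erefl _)) (eq_bigr d); last by move=> i; lia.
move: d0; rewrite (bigID (fun i => d i < 0)) /= e => /eqP.
by rewrite addrC subr_eq0 => /eqP.
Qed.

(** Each gap splits as [|d i| + |d j|]. The first parts sum to [depth d] times the number of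
    negative indices, the second to [depth d] times the number of the others. *)
Lemma sum_gap d : \sum_i d i = 0 ->
  (\sum_(i | ~~ (d i < 0)%R) \sum_(j | (d j < 0)%R) absz (d i - d j)%R)%N = (n
    * depth d)%N.
Proof.
move=> d0.
transitivity (\sum_(i | ~~ (d i < 0)%R) \sum_(j | (d j < 0)%R)
    (absz (d i) + absz (d j)))%N.
  by apply: eq_bigr => i di; apply: eq_bigr => j dj; lia.
under eq_bigr do rewrite big_split/= sum_nat_const -/(depth d).
rewrite big_split/= -big_distrr/= depth_nonneg// sum_nat_const -mulnDl.
by congr (_ * _)%N; rewrite -[RHS]card_ord -(cardC (fun i => d i < 0)).
Qed.

Lemma le_depth d i : \sum_j d j = 0 -> (absz (d i) <= depth d)%N.
Proof.
move=> d0; case: (ltP (d i) 0) => di; last rewrite -depth_nonneg//.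
  by rewrite /depth (bigD1 i)//= leq_addr.
by rewrite (bigD1 i)/= ?leq_addr// -leNgt.
Qed.

Section ThinMatrices.
Variable S : nat.
Implicit Type c : {ffun 'I_n * 'I_n * 'I_S -> F}.

(** The index [t] stands for degree [- (t + 1)]; degrees below [- S] get coefficient 0. *)
Definition thin_coef c (i j : 'I_n) (k : int) : F :=
  if k < 0 then oapp (fun t => c (i, j, t)) 0 (insub (absz k).-1) else 0.

Lemma thin_coef_bounded c i j : exists N, lbd N (thin_coef c i j).
Proof. by exists 0 => k k0; rewrite /thin_coef ltNge ltW. Qed.

Definition thinmx c : 'M[K]_n :=
  \matrix_(i, j) Laurent (thin_coef_bounded c i j).

Lemma thinmx_inj : injective thinmx.
Proof.
have thinmxE c i j (t : 'I_S) : thinmx c i j (- t.+1%:Z) = c (i, j, t).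
  rewrite mxE; transitivity (thin_coef c i j (- t.+1%:Z)) => //.
  have t0 : (- t.+1%:Z < 0) = true by lia.
  rewrite /thin_coef t0 (_ : (absz _).-1 = t) ?valK//; lia.
by move=> c c' cc'; apply/ffunP => -[[i j] t]; rewrite -!thinmxE cc'.
Qed.

Definition thin_support d : pred ('I_n * 'I_n * 'I_S) :=
  [pred x : 'I_n * 'I_n * 'I_S | (~~ (d x.1.1 < 0)) && (d x.1.2 < 0) &&
    (x.2 < absz (d x.1.1 - d x.1.2)%R)%N].

Lemma thinmx_thin d c : c \in pffun_on 0 (thin_support d) predT ->
  thin d (thinmx c).
Proof.
move=> /pffun_onP[/supportP cS _] i j k; rewrite mxE /= /thin_coef.
case: ltP => [k0|]; last by rewrite eqxx.
case: insubP => [t _ tk /=|]; last by rewrite eqxx.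
move=> cne; have : (i, j, t) \in thin_support d.
  by apply: contraR cne => /cS ->.
have {}tk : nat_of_ord t = (absz k).-1 := tk.
by rewrite inE /= tk => /andP[/andP[di dj] tl]; split=> //; lia.
Qed.

Lemma card_thin_support d : \sum_i d i = 0 -> ((depth d).*2 <= S)%N ->
  #|thin_support d| = (n * depth d)%N.
Proof.
move=> d0 dS; rewrite -sum_gap// -sum1_card /thin_support.
rewrite pair_big_dep/=.
transitivity (\sum_(p : 'I_n * 'I_n | ~~ (d p.1 < 0)%R && (d p.2 < 0)%R)
   \sum_(t < S | (t < absz (d p.1 - d p.2)%R)%N) 1)%N.
  by rewrite pair_big_dep/=; apply: eq_bigl => x; rewrite !inE.
apply: eq_bigr => -[i j] /= /andP[di dj].
(* The cutoff loses nothing: [|d i - d j| <= 2 * depth d <= S]. *)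
rewrite -(big_ord_widen _ (fun=> 1%N)) ?sum1_card ?card_ord//.
by have := le_depth i d0; have := le_depth j d0; move: dS; lia.
Qed.

End ThinMatrices.

Variables (R : realType) (mu : probability (Ln_borel F n) R).
Hypothesis hmu : G_invariant mu.

Lemma orb_measurable g d : absv (\det g) = 1 ->
  measurable (orb g d : set (Ln_borel F n)).
Proof. by move=> g1; apply: sub_sigma_algebra; exact: orb_open. Qed.

Lemma mu_orb_translate g d : absv (\det g) = 1 ->
    mu (orb g d) = mu (orb 1%:M d).
Proof.
move=> g1; have m1 : measurable (orb 1%:M d : set (Ln_borel F n)).
  by apply: orb_measurable; rewrite det1 absv1.
by rewrite -(hmu (mkG g1) m1) Ltrans_orb.
Qed.

Lemma mu_orb_le g d : absv (\det g) = 1 -> \sum_i d i = 0 ->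
  (mu (orb g d) <= (#|F|%:R ^- (n * depth d))%:E)%E.
Proof.
move=> g1 d0; rewrite mu_orb_translate//.
(* [P] indexes the matrices [Z] by their free coefficients. *)
pose S := (depth d).*2; pose P := pffun_on 0 (@thin_support S d) (@predT F).
pose E (i : 'I_#|P|) := orb (1%:M + thinmx (enum_val i)) d.
have th i : thin d (thinmx (enum_val (i : 'I_#|P|))).
  by apply: thinmx_thin; exact: enum_valP i.
have E1 i : absv (\det (1%:M + thinmx (enum_val (i : 'I_#|P|)))) = 1.
  by apply: U1_det; exact: thin_U1 (th i).
have mE i : measurable (E i : set (Ln_borel F n)) by exact: orb_measurable.
have tE : trivIset setT E.
  move=> i j _ _ ij; apply: enum_val_inj; apply: thinmx_inj.
  exact: (orb_disjoint (th i) (th j) ij).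
have := @measure_bigsetU_ord _ _ _ mu _ xpredT E mE tE.
rewrite (eq_bigr (fun=> mu (orb 1%:M d))); last by move=> i _;
  exact: mu_orb_translate.
have mUE : measurable (\big[setU/set0]_(i < #|P|) E i : set (Ln_borel F n)).
  exact: bigsetU_measurable.
have := probability_le1 mu mUE => /[swap] ->.
have fin : mu (orb 1%:M d) \is a fin_num.
  by apply: fin_num_measure; apply: orb_measurable; rewrite det1 absv1.
rewrite -(fineK fin) sumEFin sumr_const card_ord /P card_pffun_on
  card_thin_support//.
rewrite !lee_fin -[_ *+ _]mulr_natr natrX => h.
have q0 : (0 : R) < #|F|%:R ^+ (n * depth d).
  by rewrite exprn_gt0// ltr0n (ltn_trans _ (card_finNzRing_gt1 F)).
by rewrite -ler_pdivlMr ?mul1r in h.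
Qed.

End OrbitMeasure.

(** * Bounds on the alpha function *)

Section Minors.
Variables (F : finFieldType) (n : nat).
Local Notation K := (laurent F).

(** The Cauchy-Binet expansion before grouping by the image of [f]: multilinearity in the rows of
    the product. *)
Lemma det_mulmx_minors (R : comPzRingType) k (A : 'M[R]_(k, n)) (V : 'M[R]_(n,
    k)) :
  \det (A *m V) =
  \sum_(f : {ffun 'I_k -> 'I_n}) (\prod_i A i (f i)) * \det (rowsub f V).
Proof.
transitivity (\sum_(s : 'S_k) \sum_(f : {ffun 'I_k -> 'I_n})
    (\prod_i A i (f i)) * ((-1) ^+ s * \prod_i V (f i) (s i))).
  apply: eq_bigr => s _; under eq_bigr do rewrite mxE.
  rewrite bigA_distr_bigA big_distrr /=; apply: eq_bigr => f _.
  by rewrite big_split /= mulrCA.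
rewrite exchange_big /=; apply: eq_bigr => f _; rewrite -big_distrr /=.
congr (_ * _); apply: eq_bigr => s _; congr (_ * _).
by apply: eq_bigr => i _; rewrite mxE.
Qed.

Lemma ltn_enum_val (A : {set 'I_n}) (i j : 'I_#|A|) :
  (i < j)%N -> (enum_val i < enum_val j)%N.
Proof.
move=> ij; have x0 : 'I_n := enum_val i.
have sA : sorted (fun x y : 'I_n => (x < y)%N) (enum A).
  rewrite /enum_mem sorted_filter//; first by move=> y x z; exact: ltn_trans.
  have := iota_ltn_sorted 0 n; rewrite -val_enum_ord sorted_map enumT.
  exact: sub_sorted.
rewrite !(enum_val_nth x0).
have tr : transitive (fun x y : 'I_n => (x < y)%N) by move=> y x z;
  exact: ltn_trans.
by apply: (sorted_ltn_nth tr x0 sA) => //; rewrite inE -cardE.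
Qed.

Lemma injective_sort k (f : 'I_k -> 'I_n) : injective f ->
  exists2 f' : {ffun 'I_k -> 'I_n},
    [forall i : 'I_k, forall j : 'I_k, (i < j)%N ==> (f' i < f' j)%N] &
    exists s : 'S_k, f =1 f' \o s.
Proof.
move=> f_inj; pose A := [set f i | i : 'I_k].
have cA : #|A| = k by rewrite card_imset// card_ord.
have fA i : f i \in A by exact: imset_f.
pose s i := cast_ord cA (enum_rank_in (fA i) (f i)).
pose f' := [ffun i => enum_val (cast_ord (esym cA) i)].
have f's i : f' (s i) = f i by rewrite ffunE cast_ordK enum_rankK_in.
have s_inj : injective s.
  by move=> i j e; apply: f_inj; rewrite -!f's e.
exists f'; last by exists (perm s_inj) => i /=; rewrite permE f's.
apply/forallP => i; apply/forallP => j; apply/implyP => ij.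
by rewrite !ffunE; exact: ltn_enum_val.
Qed.

(** A non-injective [f] repeats a row and gives 0; an injective one is an increasing one up to a
    permutation, which changes only the sign. *)
Lemma minors_lbd k (V : 'M[K]_(n, k)) N :
  (forall f : {ffun 'I_k -> 'I_n},
    [forall i : 'I_k, forall j : 'I_k, (i < j)%N ==> (f i < f j)%N] ->
    lbd N (\det (rowsub f V))) ->
  forall f : 'I_k -> 'I_n, lbd N (\det (rowsub f V)).
Proof.
move=> VN f; have [/injectiveP f_inj|/injectivePn[i [j ij fij]]] :=
  boolP (injectiveb f).
  have [f' /VN Vf' [s fs]] := injective_sort f_inj.
  have -> : rowsub f V = row_perm s (rowsub f' V).
    by apply/matrixP => i j; rewrite !mxE fs.
  rewrite row_permE det_mulmx det_perm.
  by case: odd_perm; rewrite ?expr1 ?expr0 ?mul1r// mulN1r; exact: lbdN.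
rewrite (determinant_alternate ij); first exact: lbd0.
by move=> l; rewrite !mxE fij.
Qed.

Lemma minor_mul_lbd k (u : 'M[K]_n) (V : 'M[K]_(n, k)) N :
  (forall i j, lbd 0 (u i j)) ->
  (forall f : 'I_k -> 'I_n, lbd N (\det (rowsub f V))) ->
  forall f : 'I_k -> 'I_n, lbd N (\det (rowsub f (u *m V))).
Proof.
move=> ub VN f; have -> : rowsub f (u *m V) = rowsub f u *m V.
  by apply/matrixP => i j; rewrite !mxE; apply: eq_bigr => l _; rewrite mxE.
rewrite det_mulmx_minors; apply: lbd_sum => f' _; rewrite -(add0r N).
apply: lbdM => //.
have ub' i : lbd 0 (rowsub f u i (f' i)) by rewrite mxE.
have [+ _] := @lead_prod _ _ (fun=> 0) _ ub'.
by rewrite big1_eq.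
Qed.

(** Norms are 0 or powers of [q], so a strict bound gains one degree. *)
Lemma wedge_norm_lbd k (V : 'M[K]_(n, k)) N : wedge_norm V < #|F|%:R ^ N ->
  forall f : 'I_k -> 'I_n, lbd (N - 1) (\det (rowsub f V)).
Proof.
move=> VN; apply: minors_lbd => f f_incr i Ni.
have /absv_ltP : absv (\det (rowsub f V) - 0) < #|F|%:R ^ N.
  rewrite subr0; apply: le_lt_trans VN.
  exact: (@le_bigmax_cond _ _ _ 0 f _ (fun f => absv (\det (rowsub f V)))).
by move=> ->//; lia.
Qed.

(** By Cramer's rule: cofactors have degree at most 0, and the determinant is a unit of the
    valuation ring. *)
Lemma invmx_lbd (u : 'M[K]_n) : absv (\det u) = 1 ->
  (forall i j, lbd 0 (u i j)) -> forall i j, lbd 0 (invmx u i j).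
Proof.
move=> u1 ub i j; rewrite /invmx det1_unitmx// mxE -(addr0 0); apply: lbdM.
  by have /absv_eq1[] := absvV_eq1 u1.
rewrite mxE /cofactor; set M := row' _ _.
have : lbd 0 (\det M).
  have Mb a b : lbd 0 (M a b) by rewrite !mxE.
  have [+ _] := @lead_det _ _ (fun=> 0) M Mb.
  by rewrite big1_eq.
by rewrite -signr_odd; case: odd; rewrite ?expr1 ?expr0 ?mul1r// mulN1r;
  exact: lbdN.
Qed.

End Minors.

(** * Lower bound for the norms of sublattices *)

Section AlphaBound.
Variables (F : finFieldType) (n : nat).
Local Notation K := (laurent F).
Implicit Types (d : 'I_n -> int) (X : Ln F n).

Lemma sum_inj_depth k d (f : 'I_k -> 'I_n) : injective f ->
  - (depth d)%:Z <= \sum_i d (f i).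
Proof.
move=> f_inj; rewrite /depth (big_morph Posz PoszD (erefl _)) -sumrN.
rewrite -(big_imset d (in2W f_inj)) /=.
rewrite big_mkcond [leRHS]big_mkcond /=; apply: ler_sum => i _.
by case: ifP; case: ifP; lia.
Qed.

Lemma sublattice_basis_poly X g k (V : 'M[K]_(n, k)) : Lnval X g ->
  sublattice_basis (lattice X) V -> polymx (invmx g *m V).
Proof.
move=> Xg [_ VX] i j; rewrite -mulmx_col.
have : lattice X (col j V).
  apply: VX; exists (delta_mx j 0); last by rewrite colE.
  move=> l; apply/range_lpolyP; rewrite mxE.
  by case: (_ && _) => //; exact: lpolynomial1.
move=> [h /(Lnval_rel Xg)[gamma gG ->] [w wp ->]].
rewrite -mulmxA mulKmx ?(det1_unitmx (Lnval_det Xg))//.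
by apply: polymx_mul => [|a b]; [exact: Gamma_poly|rewrite ord1;
  exact/range_lpolyP].
Qed.

(** Write the lattice basis as [u D] with [u] invertible over the valuation ring. Then
    [u^-1 V = D W] with [W] polynomial, and a nonzero maximal minor of [D W] is
    [x ^ (\sum_i d (f i))] times a nonzero polynomial, of degree at least [- depth d]. Applying
    [u^-1] does not raise the bound on the minors. *)
Lemma wedge_norm_ge X C d h k (V : 'M[K]_(n, k)) : C \in unitmx ->
  \sum_j d j = 0 -> box d h ->
  Lnval X (map_mx (@lconst F) C *m dmono F d *m h) ->
  sublattice_basis (lattice X) V -> #|F|%:R ^ (- (depth d)%:Z) <= wedge_norm V.
Proof.
move=> Cu d0 [hU hd]; set g := _ *m h => Xg VX; have [rV _] := VX.
pose u := map_mx (@lconst F) C *m (dmono F d *m h *m dmonoV F d).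
have gE : g = u *m dmono F d.
  by rewrite /u -!mulmxA dmonoVK mulmx1 /g !mulmxA.
have ub i j : lbd 0 (u i j).
  rewrite mxE; apply: lbd_sum => l _; rewrite -(addr0 0); apply: lbdM.
    by rewrite mxE; exact: lbd_const.
  exact: U1_lbd.
have u1 : absv (\det u) = 1.
  by have := Lnval_det Xg; rewrite gE det_mulmx det_dmono d0 mono0 mulr1.
have uu := det1_unitmx u1.
pose W := invmx g *m V; have Wp : polymx W := sublattice_basis_poly Xg VX.
have VE : invmx u *m V = dmono F d *m W.
  rewrite -[V in LHS](mulKVmx (det1_unitmx (Lnval_det Xg))) -/W gE.
  by rewrite -mulmxA mulKmx.
rewrite leNgt; apply/negP => /wedge_norm_lbd Vb.
have {}Vb := minor_mul_lbd (invmx_lbd u1 ub) Vb.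
have VEfull : row_full (dmono F d *m W).
  by rewrite -VE /row_full eqmxMfull ?rV// row_full_unit unitmx_inv.
pose f := fullrankfun VEfull.
have := fullrowsub_unit VEfull; rewrite -/f unitmxE unitfE.
have := Vb f; rewrite VE.
have -> : rowsub f (dmono F d *m W) = diag_mx (\row_i mono F (d (f i))) *m
  rowsub f W.
  by apply/matrixP => i j; rewrite mxE dmonoMl mul_diag_mx !mxE.
rewrite det_mulmx det_diag.
have -> : \prod_i (\row_i mono F (d (f i))) 0 i = mono F (\sum_i d (f i)).
  by rewrite -mono_prod; apply: eq_bigr => i _; rewrite mxE.
have fd := sum_inj_depth d (@fullrankfun_inj _ _ _ _ VEfull).
rewrite -/f in fd; move: (\sum_i _) fd => N Nd.
have : lpolynomial (\det (rowsub f W)).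
  by apply: lpolynomial_det => i j; rewrite mxE.
move: (\det _) => p pp pb; rewrite mulf_eq0 negb_or => /andP[_ /ldegP[pd _]].
have p0 : 0 <= ldeg p by rewrite leNgt; apply: contra pd => /pp ->.
have := pb (N + ldeg p); rewrite lcoef_monoM addrAC subrr add0r => pe.
by rewrite pe ?eqxx// in pd; lia.
Qed.

Lemma wedge_norm_ge0 k (V : 'M[K]_(n, k)) : 0 <= wedge_norm V.
Proof. exact: bigmax_ge_id. Qed.

Variable R : realType.

Lemma alpha_ge0 X : (0 <= alpha R (lattice X))%E.
Proof.
apply: le_trans (le_bigmax _ _ ord0).
(* The sublattice of rank 0 keeps the supremum away from [-oo]. *)
have V0 : sublattice_basis (lattice X) (0 : 'M[K]_(n, 0)).
  split=> [|_ [a _ <-]]; first exact: mxrank0.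
  have [g Xg] := Lnval_ex X; exists (Gval g).
    by rewrite Xg; exists 1%:M; [exact: Gamma1|rewrite mulmx1].
  exists 0; last by rewrite mul0mx mulmx0.
  by move=> i; apply/range_lpolyP; rewrite mxE; exact: lpolynomial0.
apply: le_trans (ereal_sup_ubound _); last by exists 0.
by rewrite lee_fin ler0q invr_ge0 wedge_norm_ge0.
Qed.

Lemma alpha_le X C d h : C \in unitmx -> \sum_j d j = 0 -> box d h ->
  Lnval X (map_mx (@lconst F) C *m dmono F d *m h) ->
  (alpha R (lattice X) <= (#|F|%:R ^+ depth d)%:E)%E.
Proof.
move=> Cu d0 hd Xg; apply: bigmax_le; first by rewrite leNye.
move=> k _; apply: ge_ereal_sup => _ [V VX <-].
have := wedge_norm_ge Cu d0 hd Xg VX.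
rewrite -exprnN => qV; rewrite lee_fin -(ratr_nat R) -rmorphXn ler_rat.
have q0 : (0 : rat) < #|F|%:R ^+ depth d.
  by rewrite exprn_gt0// ltr0n (ltn_trans _ (card_finNzRing_gt1 F)).
have w0 : 0 < wedge_norm V by apply: lt_le_trans qV; rewrite invr_gt0.
by rewrite -[leRHS]invrK lef_pV2// posrE invr_gt0.
Qed.

End AlphaBound.

(** * Integration *)

Section IntegralBound.
Local Open Scope ereal_scope.
Context {d0 : measure_display} {T : measurableType d0} {R : realType}.
Variable mu : {measure set T -> \bar R}.

(** The integral is a supremum over the simple functions below the integrand, and a larger integrand
    has more of them. *)
Lemma le_integral_nonmeasurable (f g : T -> \bar R) :
  (forall x, 0 <= f x) -> (forall x, f x <= g x) ->
  \int[mu]_x f x <= \int[mu]_x g x.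
Proof.
move=> f0 fg; have g0 x : 0 <= g x := le_trans (f0 x) (fg x).
rewrite !ge0_integralTE//; apply: ereal_sup_le => _ [h hf <-].
by exists h => // x; exact: le_trans (hf x) (fg x).
Qed.

Lemma measure_bigsetU_le (I : Type) (r : seq I) (P : pred I) (A : I -> set T) :
  (forall i, P i -> measurable (A i)) ->
  mu (\big[setU/set0]_(i <- r | P i) A i) <= \sum_(i <- r | P i) mu (A i).
Proof.
move=> mA; elim: r => [|i r IHr]; first by rewrite !big_nil measure0.
rewrite !big_cons; case: ifP => // Pi; apply: (le_trans (measureU2 _ _ _)).
- exact: mA.
- exact: bigsetU_measurable.
- exact: leeD2l.
Qed.

(** The function is dominated by the series of [b s] times the indicator of [A s], which is
    integrated termwise. *)
Lemma integral_cover_lty (f : T -> \bar R) (A : nat -> set T) (b : nat ->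
    R) (M : R) :
  (forall x, 0 <= f x) -> (forall s, measurable (A s)) ->
  (forall s, (0 <= b s)%R) -> (forall x, exists2 s, A s x & f x <= (b s)%:E) ->
  (forall N, \sum_(0 <= s < N) (b s)%:E * mu (A s) <= M%:E) ->
  \int[mu]_x f x < +oo.
Proof.
move=> f0 mA b0 fb bM.
pose g s x := (b s)%:E * (\1_(A s) x)%:E : \bar R.
have g0 s x : 0 <= g s x by rewrite mule_ge0 ?lee_fin.
have mg s : measurable_fun setT (g s).
  apply: emeasurable_funM; first exact: measurable_cst.
  by apply/measurable_EFinP; exact: measurable_indic.
apply: (@le_lt_trans _ _ (\int[mu]_x \sum_(0 <= s <oo) g s x)).
  apply: le_integral_nonmeasurable => // x; have [s Asx fs] := fb x.
  apply: (le_trans fs).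
  apply: le_trans (@nneseries_lim_ge R (g^~ x) xpredT 0 s.+1 (fun s _ _ => g0 s
    x)).
  rewrite big_nat_recr//= /g indicE mem_set// mule1 leeDr//.
  by apply: sume_ge0 => i _; exact: g0.
rewrite integral_nneseries//.
apply: (@le_lt_trans _ _ M%:E); last exact: ltry.
apply: lime_le; first by apply: is_cvg_nneseries => s _ _; exact: integral_ge0.
apply: nearW => N; apply: le_trans (bM N); apply: lee_sum => s _.
rewrite (_ : \int[mu]_x g s x = (b s)%:E * mu (A s))//.
transitivity ((b s)%:E * \int[mu]_x (\1_(A s) x)%:E).
  apply: ge0_integralZl_EFin => //.
  by apply/measurable_EFinP; exact: measurable_indic.
by rewrite integral_indic// setIT.
Qed.

End IntegralBound.

(* With [r = 1 + 2 ^- n.+1], Bernoulli gives [r ^+ n.+1 <= 2 <= q] and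
   [2 s + 1 <= 2 ^+ n.+2 * r ^+ s], so the sum is dominated by a geometric one.
     *)
Lemma poly_geometric_bound (R : realType) (n q : nat) : (1 < q)%N ->
  exists M : R, forall N,
    \sum_(0 <= s < N) (s.*2.+1%:R ^+ n * q%:R ^- s) <= M.
Proof.
move=> q1; pose e : R := 2 ^- n.+1; pose r := 1 + e.
have e0 : 0 < e by rewrite invr_gt0 exprn_gt0.
have e1 : e <= 1 by rewrite invf_le1 ?exprn_gt0// exprn_ege1// ler1n.
have r1 : 1 < r by rewrite ltrDl.
have r0 : 0 < r := lt_trans ltr01 r1.
have bern k : 1 + k%:R * e <= r ^+ k.
  elim: k => [|k IHk]; first by rewrite mul0r addr0 expr0.
  rewrite exprS; apply: (@le_trans _ _ (r * (1 + k%:R * e)));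
    last by rewrite ler_wpM2l ?(ltW r0).
  rewrite /r mulrDl mul1r mulrDr mulr1 -addrA lerD2l -natr1 mulrDl mul1r lerD2l.
  by rewrite lerDl mulr_ge0 ?(ltW e0)// mulr_ge0 ?(ltW e0).
(* The chord of the convex function [(1 + e) ^+ k] on the interval from 0 to 1. *)
have r2 k : r ^+ k <= 1 + (2 ^+ k - 1) * e.
  elim: k => [|k IHk]; first by rewrite !expr0 subrr mul0r addr0.
  rewrite exprS; apply: (@le_trans _ _ (r * (1 + (2 ^+ k - 1) * e))).
    by rewrite ler_wpM2l ?(ltW r0).
  have : 0 <= (2 ^+ k - 1) * (e * (1 - e)).
    by rewrite !mulr_ge0 ?subr_ge0 ?(ltW e0) ?exprn_ege1 ?ler1n.
  by rewrite /r exprS; lra.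
have rq : r ^+ n.+1 <= q%:R.
  apply: (@le_trans _ _ 2); last by rewrite ler_nat.
  apply: le_trans (r2 _) _.
  have : 2 ^+ n.+1 * e = 1 by rewrite mulfV// expf_neq0// pnatr_eq0.
  by move=> ee; rewrite mulrBl ee mul1r; lra.
(* By [bern] and [e <= 1], [2 s + 1 <= 2 / e * (1 + s e) <= 2 / e * r ^+ s]. *)
pose c : R := (2 * e^-1) ^+ n.
exists (c * (1 - r^-1)^-1) => N.
have t1 s : s.*2.+1%:R ^+ n * q%:R ^- s <= c * r^-1 ^+ s :> R.
  have h1 : s.*2.+1%:R <= 2 * e^-1 * r ^+ s :> R.
    have := bern s; rewrite mulrAC ler_pdivlMr// -addn1 natrD -mul2n natrM.
    have : 0 <= s%:R * e by rewrite mulr_ge0// ltW.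
    nra.
  have h2 : s.*2.+1%:R ^+ n <= c * r ^+ (s * n) :> R.
    by rewrite exprM /c -exprMn lerXn2r// nnegrE ?mulr_ge0 ?invr_ge0 ?(ltW e0)
      ?exprn_ge0 ?(ltW r0).
  have h3 : q%:R ^- s <= r ^- (s * n.+1) :> R.
    rewrite lef_pV2 ?posrE ?exprn_gt0 ?ltr0n ?(ltnW q1)//.
    by rewrite mulnC exprM lerXn2r// nnegrE ?exprn_ge0// ltW.
  have q0 : (0 : R) <= q%:R ^- s by rewrite invr_ge0 exprn_ge0.
  have h4 : (c * r ^+ (s * n)) * r ^- (s * n.+1) = c * r^-1 ^+ s.
    rewrite mulnS exprD -mulrA; congr (_ * _).
    by rewrite invfM mulrCA mulfV ?mulr1 ?exprVn// expf_neq0// gt_eqF.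
  rewrite -h4; apply: ler_pM => //; exact: exprn_ge0.
apply: (@le_trans _ _ (\sum_(0 <= s < N) c * r^-1 ^+ s)); first exact: ler_sum.
have c0 : 0 <= c by rewrite exprn_ge0// mulr_ge0// invr_ge0 ltW.
rewrite -mulr_sumr ler_wpM2l//.
have ri1 : r^-1 < 1 by rewrite invf_lt1.
have z0 : 0 < 1 - r^-1 by rewrite subr_gt0.
have -> : \sum_(0 <= s < N) r^-1 ^+ s = (1 - r^-1 ^+ N) * (1 - r^-1)^-1.
  apply: (canRL (mulfK (lt0r_neq0 z0))).
  elim: N => [|N IHN]; first by rewrite big_geq// mul0r expr0 subrr.
  by rewrite big_nat_recr//= mulrDl IHN exprSr; ring.
by rewrite ler_piMl ?invr_ge0 ?(ltW z0)// gerBl exprn_ge0// invr_ge0 ltW.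
Qed.

(** * Summation over the depth *)

Section AlphaMoment.
Variables (F : finFieldType) (n : nat).
Local Notation K := (laurent F).

(** Degrees of depth [s] and sum 0 lie between [- s] and [s]; the shift encodes them in a finite
    type. *)
Definition shifted s (t : {ffun 'I_n -> 'I_(s.*2.+1)}) (i : 'I_n) : int :=
  (t i)%:Z - s%:Z.

Definition type_ok s (x : 'M[F]_n * {ffun 'I_n -> 'I_(s.*2.+1)}) : bool :=
  [&& x.1 \in unitmx, \sum_i shifted x.2 i == 0 & depth (shifted x.2) == s].

Definition type_orb s (x : 'M[F]_n * {ffun 'I_n ->
  'I_(s.*2.+1)}) : set (Ln F n) :=
  orb (map_mx (@lconst F) x.1 *m dmono F (shifted x.2)) (shifted x.2).

Definition depth_set s : set (Ln F n) :=
  \big[setU/set0]_(x | @type_ok s x) type_orb x.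

Lemma type_orb_det s x : @type_ok s x ->
  absv (\det (map_mx (@lconst F) x.1 *m dmono F (shifted x.2))) = 1.
Proof.
move=> /and3P[xu /eqP x0 _].
by rewrite det_mulmx det_dmono x0 mono0 mulr1 Gamma_det//; exact: Gamma_const.
Qed.

Lemma depth_set_cover (X : Ln F n) : exists s, depth_set s X.
Proof.
have [g Xg] := Lnval_ex X.
have [C [d [Cu d0 [h hd [gamma gG e]]]]] := reduction (Gval_det g).
exists (depth d); pose s := depth d.
have tP i : (absz (d i + s%:Z)%R < s.*2.+1)%N.
  by have := le_depth i d0; rewrite -/s; lia.
pose t := [ffun i => Ordinal (tP i)].
have td : shifted t = d.
  apply/funext => i; rewrite /shifted ffunE /=.
  by have := le_depth i d0; rewrite -/s; lia.
have xok : type_ok (C, t) by rewrite /type_ok /= td Cu d0 !eqxx.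
rewrite /depth_set (bigD1 (C, t))//; left; rewrite /type_orb /= td.
by exists h => //; rewrite -e Xg; exists gamma.
Qed.

Lemma alpha_depth_set (R : realType) s X : depth_set s X ->
  (alpha R (lattice X) <= (#|F|%:R ^+ s)%:E)%E.
Proof.
rewrite /depth_set; elim/big_ind: _ => //; first by move=> A B AX BX [/AX|/BX].
move=> [C t] /and3P[/= Cu /eqP d0 /eqP ds] [h hd Xh].
by have := alpha_le R Cu d0 hd Xh; rewrite ds.
Qed.

Variables (R : realType) (mu : probability (Ln_borel F n) R).
Hypothesis hmu : G_invariant mu.

Lemma depth_set_measurable s : measurable (depth_set s : set (Ln_borel F n)).
Proof.
by apply: bigsetU_measurable => x xok; apply: orb_measurable;
  exact: type_orb_det.
Qed.

Lemma mu_depth_set s : (mu (depth_set s) <=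
  ((#|{: 'M[F]_n}|%:R * s.*2.+1%:R ^+ n) * #|F|%:R ^- (n * s))%:E)%E.
Proof.
have mO x : @type_ok s x -> measurable (type_orb x : set (Ln_borel F n)).
  by move=> xok; apply: orb_measurable; exact: type_orb_det.
apply: (le_trans (measure_bigsetU_le mu _ mO)).
apply: (@le_trans _ _ (\sum_(x | @type_ok s x) (#|F|%:R ^- (n * s))%:E)%E).
  apply: lee_sum => x xok; have /and3P[_ /eqP x0 /eqP xs] := xok.
  by have := mu_orb_le hmu (type_orb_det xok) x0; rewrite xs.
(* The pairs are counted crudely, by all matrices over [F] and all functions. *)
rewrite sumEFin lee_fin sumr_const -[leLHS]mulr_natl ler_wpM2r//.
rewrite -natrX -natrM ler_nat -[X in (_ * X ^ _)%N]card_ord -[X in (_ * _ ^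
  X)%N]card_ord.
by rewrite -card_ffun -card_prod max_card.
Qed.

Lemma alpha_moment m : (m < n)%N ->
  (\int[mu]_X (alpha R (lattice X)) ^+ m < +oo)%E.
Proof.
move=> mn; have q1 := card_finNzRing_gt1 F.
have q0 : (0 : R) < #|F|%:R by rewrite ltr0n (ltn_trans _ q1).
have [M MP] := poly_geometric_bound R n q1.
apply: (@integral_cover_lty _ _ _ mu _ depth_set (fun s => #|F|%:R ^+ (m * s))
  (#|{: 'M[F]_n}|%:R * M)).
- by move=> X; apply: expe_ge0; exact: alpha_ge0.
- exact: depth_set_measurable.
- by move=> s; rewrite exprn_ge0// ltW.
- move=> X; have [s Xs] := depth_set_cover X; exists s => //.
  have := alpha_depth_set R Xs; have := alpha_ge0 R X.
  case: (alpha R _) => [a| |]//; rewrite !lee_fin => a0 aq.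
  by rewrite -EFin_expe lee_fin mulnC exprM lerXn2r// nnegrE exprn_ge0.
move=> N; apply: (@le_trans _ _ (\sum_(0 <= s < N)
    (#|{: 'M[F]_n}|%:R * (s.*2.+1%:R ^+ n * #|F|%:R ^- s))%:E)%E).
  apply: lee_sum => s _.
  apply: (@le_trans _ _ ((#|F|%:R ^+ (m * s))%:E *
    ((#|{: 'M[F]_n}|%:R * s.*2.+1%:R ^+ n) * #|F|%:R ^- (n * s))%:E)%E).
    by rewrite lee_wpmul2l ?lee_fin ?exprn_ge0 ?(ltW q0)//; exact: mu_depth_set.
  rewrite -EFinM lee_fin mulrCA -mulrA ler_wpM2l// ler_wpM2l ?exprn_ge0//.
  (* Here [m < n] enters: [q ^ (m s) / q ^ (n s) <= q ^ (- s)]. *)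
  rewrite ler_pdivrMr ?exprn_gt0// mulrC ler_pdivlMr ?exprn_gt0// -exprD.
  by rewrite ler_weXn2l ?ler1n ?(ltnW q1)// -mulSnr leq_mul2r mn orbT.
by rewrite sumEFin lee_fin -mulr_sumr ler_wpM2l.
Qed.

End AlphaMoment.

Theorem theorem1p9 (R : realType) (p e : nat) (hp : prime p) (hp2 : odd p)
    (F : finFieldType) (hF : #|F| = (p ^ e)%N)
    (n m : nat) (hm : (1 <= m)%N) (hmn : (m < n)%N)
    (mu : probability (Ln_borel F n) R) (hmu : G_invariant mu) :
  (\int[mu]_X (alpha R (lattice X)) ^+ m < +oo)%E.
Proof. exact: alpha_moment. Qed.
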